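(* Let $T(t,\tau)$ be an evolution family on a Banach space $X$ and $\|\cdot\|_t$ a family of norms, and assume there exist $M,a>0$ with $\|T(t,s)x\|_t\le M(t/s)^a\|x\|_s$ for all $t\ge s\ge1$, $x\in X$. Then the following are equivalent: (1) $T(t,\tau)$ admits a polynomial contraction with respect to $\|\cdot\|_t$; (2) for each $y\in Y_1$, the function $x:[1,\infty)\to X$ given by $x(t)=\int_1^t\frac1s T(t,s)y(s)\,ds$, $t\ge1$, belongs to $Y_0$.
   Context: Let $X$ be a Banach space with norm $\|\cdot\|$. An evolution family is a family of bounded linear operators $T(t,\tau)$ on $X$, $t\ge\tau\ge1$, such that $T(t,t)=\mathrm{Id}$ for $t\ge1$, $T(t,s)T(s,\tau)=T(t,\tau)$ for $t\ge s\ge\tau\ge1$, and for each $\tau\ge1$ and $x\in X$ the map $s\mapsto T(s,\tau)x$ is continuous on $[\tau,\infty)$. A family of norms $\|\cdot\|_t$, $t\ge1$, on $X$ is always assumed to satisfy: (i) there exist $C>0$ and $\epsilon\ge0$ with $\|x\|\le\|x\|_\tau\le C\tau^\epsilon\|x\|$ for all $x\in X$, $\tau\ge1$; (ii) $t\mapsto\|x\|_t$ is measurable for each $x\in X$. $T(t,\tau)$ admits a polynomial dichotomy with respect to $\|\cdot\|_t$ if: there are projections $P(t)$, $t\ge1$, with $P(t)T(t,\tau)=T(t,\tau)P(\tau)$ for $t\ge\tau\ge1$ such that $T(t,\tau)|_{\ker P(\tau)}:\ker P(\tau)\to\ker P(t)$ is invertible for all $t\ge\tau\ge1$; and there are $\lambda,D>0$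 such that for all $x\in X$, $t,\tau\ge1$: $\|T(t,\tau)P(\tau)x\|_t\le D(t/\tau)^{-\lambda}\|x\|_\tau$ for $t\ge\tau$, and $\|T(t,\tau)Q(\tau)x\|_t\le D(\tau/t)^{-\lambda}\|x\|_\tau$ for $t\le\tau$, where $Q(t)=\mathrm{Id}-P(t)$ and for $t<\tau$, $T(t,\tau)=(T(\tau,t)|_{\ker P(t)})^{-1}:\ker P(\tau)\to\ker P(t)$. A polynomial contraction with respect to $\|\cdot\|_t$ is a polynomial dichotomy with respect to $\|\cdot\|_t$ with $P(t)=\mathrm{Id}$ for all $t\ge1$. Function spaces: $Y$ is the Banach space of continuous $x:[1,\infty)\to X$ with $\|x\|_\infty:=\sup_{t\ge1}\|x(t)\|_t<\infty$. For a closed subspace $Z\subset X$, $Y_Z=\{x\in Y: x(1)\in Z\}$; $Y_0=Y_{\{0\}}$. $Y_1$ is the Banach space of locally (Bochner) integrable $x:[1,\infty)\to X$ (identified when equal a.e.) with $\|x\|_L:=\sup_{t\ge1}\int_t^{t+1}\|x(s)\|_s\,ds<\infty$. *)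

(* Defs.v *)
From HB Require Import structures.
From mathcomp Require Import all_boot all_order all_algebra.
From mathcomp Require Import all_classical all_reals all_analysis.
Set Implicit Arguments. Unset Strict Implicit. Unset Printing Implicit Defensive.
Import Order.TTheory GRing.Theory Num.Theory.
Import numFieldNormedType.Exports.
Local Open Scope classical_set_scope.
Local Open Scope ring_scope.

Section Defs.
Variables (R : realType) (X : completeNormedModType R).

Definition bounded_linear (A : X -> X) : Prop :=
  (forall (a : R) (u v : X), A (a *: u + v) = a *: A u + A v) /\
  exists K : R, forall u, `|A u| <= K * `|u|.

Definition evolution_family (T : R -> R -> X -> X) : Prop :=
  [/\ (forall t tau, 1 <= tau -> tau <= t -> bounded_linear (T t tau)),
      (forall t, 1 <= t -> forall x, T t t x = x),
      (forall t s tau x, 1 <= tau -> tau <= s -> s <= t ->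
          T t s (T s tau x) = T t tau x) &
      (forall tau x, 1 <= tau ->
          {within `[tau, +oo[, continuous (fun s => T s tau x)})].

Definition norm_family (N : R -> X -> R) : Prop :=
  [/\ (forall t, 1 <= t -> forall u v, N t (u + v) <= N t u + N t v),
      (forall t, 1 <= t -> forall (a : R) u, N t (a *: u) = `|a| * N t u),
      (exists (C eps : R), 0 < C /\ 0 <= eps /\
         forall x tau, 1 <= tau -> `|x| <= N tau x <= C * tau `^ eps * `|x|) &
      (forall x, measurable_fun (`[1, +oo[%classic : set R) (fun t : R => N t x))].

(* Polynomial dichotomy with respect to N, with projections P. For t < tau,
   T(t,tau) is the inverse of T(tau,t) restricted to ker P(t): the bound is
   stated for the unique z in ker P(t) with T(tau,t) z = Q(tau) x. *)
Definition polynomial_dichotomy (T : R -> R -> X -> X) (N : R -> X -> R)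
    (P : R -> X -> X) : Prop :=
  [/\ (forall t, 1 <= t -> bounded_linear (P t) /\ forall x, P t (P t x) = P t x),
      (forall t tau x, 1 <= tau -> tau <= t -> P t (T t tau x) = T t tau (P tau x)),
      (forall t tau, 1 <= tau -> tau <= t ->
         forall z, P t z = 0 -> exists! w, P tau w = 0 /\ T t tau w = z) &
      (exists lam D : R, 0 < lam /\ 0 < D /\
        (forall x t tau, 1 <= tau -> tau <= t ->
           N t (T t tau (P tau x)) <= D * (t / tau) `^ (- lam) * N tau x) /\
        (forall x t tau, 1 <= t -> t <= tau ->
           forall z, P t z = 0 -> T tau t z = x - P tau x ->
           N t z <= D * (tau / t) `^ (- lam) * N tau x))].

Definition polynomial_contraction (T : R -> R -> X -> X) (N : R -> X -> R) :=
  polynomial_dichotomy T N (fun _ x => x).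

Record simple_rep := SimpleRep {
  sr_n : nat; sr_set : 'I_sr_n -> set R; sr_vec : 'I_sr_n -> X }.
Arguments sr_set : clear implicits.
Arguments sr_vec : clear implicits.

Definition sr_fun (r : simple_rep) : R -> X :=
  fun s => \sum_(i < sr_n r) (\1_(sr_set r i) s : R) *: sr_vec r i.

Definition sr_measurable (r : simple_rep) : Prop :=
  forall i, measurable (sr_set r i).

(* integral over D of the simple function (D of finite measure) *)
Definition sr_integral (D : set R) (r : simple_rep) : X :=
  \sum_(i < sr_n r) fine (lebesgue_measure (sr_set r i `&` D)) *: sr_vec r i.

(* Bochner integral on a bounded measurable set D:
   [bochner_integral D f v] means f is Bochner integrable on D with integral v. *)
Definition bochner_integral (D : set R) (f : R -> X) (v : X) : Prop :=
  exists s : nat -> simple_rep,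
    (forall k, sr_measurable (s k)) /\
    {ae lebesgue_measure, forall t, D t -> (fun k => sr_fun (s k) t) @ \oo --> f t} /\
    (fun k => (\int[lebesgue_measure]_(t in D) (`|sr_fun (s k) t - f t| : R)%:E)%E)
        @ \oo --> 0%E /\
    (fun k => sr_integral D (s k)) @ \oo --> v.

Definition bochner_integrable (D : set R) (f : R -> X) : Prop :=
  exists v, bochner_integral D f v.

Definition in_Y0 (N : R -> X -> R) (x : R -> X) : Prop :=
  [/\ {within `[1, +oo[, continuous x},
      (exists M : R, forall t, 1 <= t -> N t (x t) <= M) &
      x 1 = 0].

Definition in_Y1 (N : R -> X -> R) (y : R -> X) : Prop :=
  (forall b, 1 <= b -> bochner_integrable `[1, b] y) /\
  exists M : R, forall t : R, 1 <= t ->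
    (\int[lebesgue_measure]_(s in `[t, (t + 1)%R]) (N s (y s))%:E <= M%:E)%E.

End Defs.

(* Main.v *)
Require Import Defs.
From HB Require Import structures.
From mathcomp Require Import all_boot all_order all_algebra.
From mathcomp Require Import all_classical all_reals all_analysis.
From mathcomp Require Import measurable_realfun ring lra.
Import Order.TTheory GRing.Theory Num.Theory.
Import numFieldNormedType.Exports.
Local Open Scope classical_set_scope.
Local Open Scope ring_scope.

(** Since [T t s x - T t u x = T t u (T u s x - x)] for [s <= u <= t] and the operators
    [T t u] are uniformly bounded on compact sets, the map [s |-> T t s x] is
    right-continuous.  Hence sampling the operators at grid points to the right of [s]
    turns simple approximations of [y] into simple approximations of [T t s (y s)],
    and the integrals defining [x t] exist.

    If [T] is a polynomial contraction, the bound on [x t] follows by halving [t]: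
    the weight contracts by [2 `^ (- lam)] while the mass of [N s (y s) / s] on
    [t / 2, t] stays bounded.  Continuity follows from [x t = T t r (x r) + tail]
    with a tail that is small when [t - r] is.

    Conversely, a gliding hump on right-continuous test functions [y] gives
    a constant [K] with [N t (x t) <= K * sup_s N s (y s)].  Testing with the function that
    equals [s / (2 ^+ j * tau) *: T s tau z] on [2 ^+ j * tau, 2 ^+ j.+1 * tau[, for
    [j < n], one finds [x t = n *: T t tau z] when [t >= 2 ^+ n * tau].  So
    [n * N t (T t tau z)] is controlled by the values of [N s (T s tau z)]: first [n = 1]
    yields boundedness of [T], then a large [n] yields a factor [1 / 2] at
    [t = 2 ^+ n * tau], and iterating gives polynomial decay. *)

Set Implicit Arguments.
Unset Strict Implicit.
Unset Printing Implicit Defensive.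

Lemma measurable_mem (d : measure_display) (T : measurableType d) (D Z : set T) :
  measurable D -> measurable Z -> measurable_fun D (fun x => x \in Z).
Proof.
move=> mD mZ; apply: (measurable_fun_bool true).
rewrite (_ : _ @^-1` _ = Z); first exact: measurableI.
by apply/seteqP; split => x; [move/set_mem|move/mem_set].
Qed.

(** * Lower integrals *)

Section lower_integral.
Local Open Scope ereal_scope.
Context {d : measure_display} {T : measurableType d} {R : realType}.
Variable mu : {measure set T -> \bar R}.

(* The integral of a nonnegative function is a supremum over the simple
   functions below it, so monotonicity needs no measurability. *)
Lemma le_integral_ge0 (D : set T) (f g : T -> \bar R) :
  (forall x, D x -> 0 <= f x) -> (forall x, D x -> f x <= g x) ->
  \int[mu]_(x in D) f x <= \int[mu]_(x in D) g x.
Proof.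
move=> f0 fg; have g0 x : D x -> 0 <= g x.
  by move=> Dx; rewrite (le_trans (f0 _ Dx))// fg.
rewrite !ge0_integralE//; apply: ereal_sup_le => _ [h hf <-].
exists h => // x; apply: le_trans (hf x) _.
by rewrite /patch; case: ifP => //; rewrite inE => /fg.
Qed.

(** Raising [g] to [+oo] on [Z] makes the comparison hold on all of [D], where lower integrals are
    monotone; the raised function is measurable and [Z] is null, so its integral is that of [g]. *)
Lemma le_integral_ge0_null (D Z : set T) (f g : T -> \bar R) :
  measurable D -> measurable Z -> mu Z = 0 ->
  (forall x, D x -> 0 <= f x) -> (forall x, D x -> 0 <= g x) ->
  measurable_fun D g -> (forall x, D x -> ~ Z x -> f x <= g x) ->
  \int[mu]_(x in D) f x <= \int[mu]_(x in D) g x.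
Proof.
move=> mD mZ Z0 f0 g0 mg fg.
pose h x := if x \in Z then +oo else g x.
have mh : measurable_fun D h.
  apply: measurable_fun_if => //.
  - exact: measurable_mem.
  - apply: measurable_funS mg => //; exact: subIsetl.
have h0 x : D x -> 0 <= h x by move=> Dx; rewrite /h; case: ifP => // _; exact: g0.
apply: (@le_trans _ _ (\int[mu]_(x in D) h x)).
  apply: le_integral_ge0 => // x Dx; rewrite /h; case: ifPn => [|/negP].
    by rewrite leey.
  by rewrite inE => Zx; exact: fg.
rewrite [leLHS](@ge0_negligible_integral _ _ _ mu D Z)//.
rewrite [leRHS](@ge0_negligible_integral _ _ _ mu D Z)//.
rewrite le_eqVlt; apply/orP; left; apply/eqP; apply: eq_integral => x.
by rewrite in_setD /h => /andP[_ /negbTE ->].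
Qed.

End lower_integral.

(** * Simple functions as lists of weighted sets *)

Section list_simple.
Context {R : realType} {X : completeNormedModType R}.
Local Notation mu := (@lebesgue_measure R).
Implicit Types (l : seq (set R * X)) (D A : set R).

(** Lists stand in for the indexed families of [simple_rep]: linear combinations become
    concatenations and proofs go by induction. The sets of a list may overlap. *)
Definition sfun l (s : R) : X := \sum_(a <- l) (\1_(a.1) s : R) *: a.2.

Definition sint D l : X := \sum_(a <- l) fine (mu (a.1 `&` D)) *: a.2.

Fixpoint smeas l : Prop := if l is a :: l' then measurable a.1 /\ smeas l' else True.

Lemma smeas_cat l1 l2 : smeas l1 -> smeas l2 -> smeas (l1 ++ l2).
Proof. by elim: l1 => //= a l1 IH [ma m1] m2; split => //; exact: IH. Qed.

Lemma smeas_map (I : Type) (F : I -> set R * X) (s : seq I) :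
  (forall i, measurable (F i).1) -> smeas [seq F i | i <- s].
Proof. by move=> mF; elim: s => //= i s IH. Qed.

Lemma sfun_cat l1 l2 s : sfun (l1 ++ l2) s = sfun l1 s + sfun l2 s.
Proof. by rewrite /sfun big_cat. Qed.

Lemma sint_cat D l1 l2 : sint D (l1 ++ l2) = sint D l1 + sint D l2.
Proof. by rewrite /sint big_cat. Qed.

Definition smap (F : X -> X) l : seq (set R * X) := [seq (a.1, F a.2) | a <- l].

Lemma smeas_smap F l : smeas l -> smeas (smap F l).
Proof. by elim: l => //= a l IH [ma ml]; split => //; exact: IH. Qed.

Lemma linear_big (F : X -> X) (I : Type) (r : seq I) (c : I -> R) (v : I -> X) :
  (forall (a : R) u w, F (a *: u + w) = a *: F u + F w) ->
  F (\sum_(i <- r) c i *: v i) = \sum_(i <- r) c i *: F (v i).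
Proof.
move=> FL; have F0 : F 0 = 0.
  have /eqP := FL 1 0 0; rewrite !scale1r addr0 -{1}[F 0]addr0.
  by rewrite (inj_eq (addrI _)) eq_sym => /eqP.
by elim: r => [|i r IH]; rewrite ?big_nil// !big_cons FL IH.
Qed.

Lemma sfun_smap F l s : (forall (a : R) u w, F (a *: u + w) = a *: F u + F w) ->
  sfun (smap F l) s = F (sfun l s).
Proof. by move=> FL; rewrite /sfun /smap big_map linear_big. Qed.

Lemma sint_smap F D l : (forall (a : R) u w, F (a *: u + w) = a *: F u + F w) ->
  sint D (smap F l) = F (sint D l).
Proof. by move=> FL; rewrite /sint /smap big_map linear_big. Qed.

Lemma scalelin (c : R) (a : R) (u w : X) :
  c *: (a *: u + w) = a *: (c *: u) + c *: w.
Proof. by rewrite scalerDr !scalerA mulrC. Qed.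

Definition srestrict A l : seq (set R * X) := [seq (a.1 `&` A, a.2) | a <- l].

Lemma smeas_srestrict A l : measurable A -> smeas l -> smeas (srestrict A l).
Proof.
move=> mA; elim: l => //= a l IH [ma ml]; split; last exact: IH.
exact: measurableI.
Qed.

Lemma sfun_srestrict A l s : sfun (srestrict A l) s = (\1_A s : R) *: sfun l s.
Proof.
rewrite /sfun /srestrict big_map scaler_sumr; apply: eq_bigr => a _ /=.
by rewrite indicI /= scalerA mulrC.
Qed.

(** Induction with [w] arbitrary: on the set of the head, its vector is absorbed into the shift. *)
Lemma measurable_sfun_comp (N : R -> X -> R) D l : measurable D ->
  (forall w, measurable_fun D (N ^~ w)) -> smeas l ->
  forall w, measurable_fun D (fun s => N s (sfun l s + w)).
Proof.
move=> mD mN; elim: l => [_ w|a l IH [ma /IH {}IH] w].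
  rewrite (_ : (fun s => _) = N ^~ w); first exact: mN.
  by apply/funext => s; rewrite /sfun big_nil add0r.
rewrite (_ : (fun s => _) = fun s => if s \in a.1
    then N s (sfun l s + (a.2 + w)) else N s (sfun l s + w)).
  apply: measurable_fun_if => //.
  - exact: measurable_mem.
  - apply: measurable_funS (IH _) => //; exact: subIsetl.
  - apply: measurable_funS (IH _) => //; exact: subIsetl.
apply/funext => s; rewrite /sfun big_cons indicE; case: ifP => _.
  by rewrite scale1r -addrA addrCA.
by rewrite scale0r add0r.
Qed.

Lemma measurable_norm_sfun D l (w : X) : measurable D -> smeas l ->
  measurable_fun D (fun s => `|sfun l s - w|).
Proof.
by move=> mD ml; apply: (@measurable_sfun_comp (fun _ w => `|w|)).
Qed.

Lemma fine_measure_split D A B : measurable D -> measurable A -> measurable B ->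
  (mu D < +oo)%E ->
  fine (mu (B `&` D)) = fine (mu (B `&` (D `&` A))) + fine (mu (B `&` (D `\` A))).
Proof.
move=> mD mA mB fD.
have fin E : measurable E -> E `<=` D -> mu E \is a fin_num.
  move=> mE ED; rewrite ge0_fin_numE//; apply: le_lt_trans fD.
  by apply: le_measure => //; rewrite inE.
have m1 : measurable (B `&` (D `&` A)) by do 2 apply: measurableI => //.
have m2 : measurable (B `&` (D `\` A)).
  by apply: measurableI => //; exact: measurableD.
rewrite -fineD; last 2 first.
  by apply: fin => // x [_ []].
  by apply: fin => // x [_ []].
rewrite -measureU//; last by apply/seteqP; split => x //= [[_ [_ Ax]] [_ [_]]].
congr (fine (mu _)); rewrite -setIUr; congr (_ `&` _).
by rewrite -setIUr setUv setIT.
Qed.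

Lemma sint_split D A l : measurable D -> measurable A -> (mu D < +oo)%E ->
  smeas l -> sint D l = sint (D `&` A) l + sint (D `\` A) l.
Proof.
move=> mD mA fD; rewrite /sint; elim: l => [|a l IH [ma ml]].
  by rewrite !big_nil addr0.
by rewrite !big_cons IH// (fine_measure_split mD mA)// scalerDl addrACA.
Qed.

(** * Seminorm estimates for integrals of simple functions *)

Definition seminorm (p : X -> R) : Prop :=
  (forall u v, p (u + v) <= p u + p v) /\ (forall (a : R) u, p (a *: u) = `|a| * p u).

Lemma seminorm0 p : seminorm p -> p 0 = 0.
Proof. by move=> [_ pZ]; rewrite -(scale0r (0 : X)) pZ normr0 mul0r. Qed.

Lemma seminormN p u : seminorm p -> p (- u) = p u.
Proof. by move=> [_ pZ]; rewrite -scaleN1r pZ normrN1 mul1r. Qed.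

Lemma seminorm_ge0 p u : seminorm p -> 0 <= p u.
Proof.
move=> sp; have := sp.1 u (- u); rewrite subrr seminorm0// seminormN//.
by rewrite -mulr2n pmulrn_lge0.
Qed.

Lemma seminorm_norm : seminorm (fun x : X => `|x|).
Proof. by split => [u v|a u]; [exact: ler_normD|exact: normrZ]. Qed.

(** Overlapping sets rule out a termwise estimate. The shift [w] makes the induction work: [D] is
    split along the head set [a.1], on which the vector [a.2] joins the shift. *)
Lemma le_sint_shift p l : seminorm p -> smeas l -> forall D w, measurable D ->
  (mu D < +oo)%E ->
  ((p (sint D l + fine (mu D) *: w))%:E <=
     \int[mu]_(s in D) (p (sfun l s + w))%:E)%E.
Proof.
move=> sp; elim: l => [_|a l IH [ma ml]] D w mD fD.
  rewrite /sint big_nil add0r.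
  under eq_integral do rewrite /sfun big_nil add0r.
  rewrite (integral_cst mu mD (p w)%:E) sp.2 ger0_norm ?fine_ge0//.
  by rewrite mulrC EFinM fineK// ge0_fin_numE.
have mpl w' E : measurable E -> measurable_fun E (fun s => (p (sfun l s + w'))%:E).
  by move=> mE; apply/measurable_EFinP; apply: (@measurable_sfun_comp (fun _ => p)).
have mpal w' E : measurable E -> measurable_fun E (fun s => (p (sfun (a :: l) s + w'))%:E).
  by move=> mE; apply/measurable_EFinP; apply: (@measurable_sfun_comp (fun _ => p)).
have p0 w' : (0 <= (p w')%:E)%E by rewrite lee_fin seminorm_ge0.
have mD1 : measurable (D `&` a.1) by exact: measurableI.
have mD2 : measurable (D `\` a.1) by exact: measurableD.
have fD1 : (mu (D `&` a.1) < +oo)%E.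
  by apply: le_lt_trans fD; apply: le_measure; rewrite ?inE//; exact: subIsetl.
have fD2 : (mu (D `\` a.1) < +oo)%E.
  by apply: le_lt_trans fD; apply: le_measure; rewrite ?inE//; exact: subDsetl.
have -> : sint D (a :: l) + fine (mu D) *: w =
   (sint (D `&` a.1) l + fine (mu (D `&` a.1)) *: (a.2 + w)) +
   (sint (D `\` a.1) l + fine (mu (D `\` a.1)) *: w).
  have -> : fine (mu D) = fine (mu (D `&` a.1)) + fine (mu (D `\` a.1)).
    by have := fine_measure_split mD ma measurableT fD; rewrite !setTI.
  rewrite {1}/sint big_cons -/(sint D l) (sint_split mD ma fD ml) (setIC a.1).
  rewrite scalerDl scalerDr [RHS]addrACA -!addrA addrCA; congr (_ + _).
  by rewrite addrCA.
rewrite -[X in (_ <= \int[mu]_(s in X) _)%E](setUIDK D a.1).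
rewrite ge0_integral_setU//; last 2 first.
- by rewrite setUIDK; exact: (mpal w _ mD).
- by apply/disj_setPS => x /= [[_ ?] [_]].
apply: (@le_trans _ _ (_ + _)%:E); first by rewrite lee_fin; exact: sp.1.
rewrite EFinD leeD//.
- apply: le_trans (IH ml _ _ mD1 fD1) _.
  apply: le_integral_ge0 => // x [_ ax]; rewrite /sfun big_cons indicE mem_set//.
  by rewrite scale1r addrCA addrA.
- apply: le_trans (IH ml _ _ mD2 fD2) _.
  apply: le_integral_ge0 => // x [_ ax]; rewrite /sfun big_cons indicE memNset//.
  by rewrite scale0r add0r.
Qed.

Lemma le_sint p l D : seminorm p -> smeas l -> measurable D -> (mu D < +oo)%E ->
  ((p (sint D l))%:E <= \int[mu]_(s in D) (p (sfun l s))%:E)%E.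
Proof.
move=> sp ml mD fD; have := le_sint_shift sp ml 0 mD fD.
by rewrite scaler0 addr0; under eq_integral do rewrite addr0.
Qed.

Lemma sfun_bounded l : exists2 C : R, 0 <= C & forall s, `|sfun l s| <= C.
Proof.
exists (\sum_(a <- l) `|a.2|) => [|s]; first by rewrite sumr_ge0.
rewrite /sfun (le_trans (ler_norm_sum _ _ _))//; apply: ler_sum => a _.
rewrite normrZ indicE; case: (_ \in _); rewrite ?normr1 ?mul1r//.
by rewrite normr0 mul0r.
Qed.

End list_simple.

(** * The Bochner integral through lists *)

Section tends0.
Context {R : realType}.

(** For nonnegative sequences this is convergence to 0; the one-sided form passes directly to
    smaller sequences, even with infinite terms. *)
Definition tends0 (u : nat -> \bar R) : Prop :=
  forall e : R, 0 < e -> \forall k \near \oo, (u k <= e%:E)%E.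

Lemma tends0P (u : nat -> \bar R) : (forall k, 0 <= u k)%E ->
  (u @ \oo --> 0%E <-> tends0 u).
Proof.
move=> u0; split.
  move=> /fine_cvgP[fu /cvgr0Pnorm_le cu] e e0.
  near=> k; have fk : u k \is a fin_num by near: k.
  have : `|fine (u k)| <= e by near: k; exact: cu.
  by rewrite ger0_norm ?fine_ge0// -lee_fin fineK.
move=> tu; apply/fine_cvgP; split.
  near=> k; rewrite ge0_fin_numE//; apply: (@le_lt_trans _ _ 1%:E); last exact: ltry.
  by near: k; exact: tu.
apply/cvgr0Pnorm_le => e e0; near=> k.
have uk : (u k <= e%:E)%E by near: k; exact: tu.
rewrite /= ger0_norm ?fine_ge0// -lee_fin fineK// ge0_fin_numE//.
by apply: le_lt_trans uk _; exact: ltry.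
Unshelve. all: by end_near. Qed.

Lemma tends0_le (u w : nat -> \bar R) : (forall k, u k <= w k)%E -> tends0 w -> tends0 u.
Proof.
by move=> uw tw e e0; near=> k; apply: le_trans (uw k) _; near: k; exact: tw.
Unshelve. all: by end_near. Qed.

Lemma tends0D (u w : nat -> \bar R) : tends0 u -> tends0 w ->
  tends0 (fun k => u k + w k)%E.
Proof.
move=> tu tw e e0; have e2 : 0 < e / 2 by rewrite divr_gt0.
near=> k; rewrite [e]splitr EFinD leeD//; near: k; [exact: tu|exact: tw].
Unshelve. all: by end_near. Qed.

Lemma tends0Z (c : R) (u : nat -> \bar R) : 0 <= c -> (forall k, 0 <= u k)%E ->
  tends0 u -> tends0 (fun k => c%:E * u k)%E.
Proof.
move=> c0 u0 tu e e0; have c1 : 0 < c + 1 by rewrite ltr_wpDl.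
have ec : 0 < e / (c + 1) by rewrite divr_gt0.
near=> k; apply: (@le_trans _ _ (c%:E * (e / (c + 1))%:E)%E).
  by rewrite lee_wpmul2l ?lee_fin//; near: k; exact: tu.
rewrite -EFinM lee_fin mulrCA ler_piMr ?(ltW e0)// ler_pdivrMr//; lra.
Unshelve. all: by end_near. Qed.

End tends0.

Section bochner.
Context {R : realType} {X : completeNormedModType R}.
Local Notation mu := (@lebesgue_measure R).
Implicit Types (l : seq (set R * X)) (D A Z : set R) (f g : R -> X)
  (r : nat -> seq (set R * X)).

Definition of_sr (q : simple_rep X) : seq (set R * X) :=
  [seq (sr_set (s := q) i, sr_vec (s := q) i) | i <- index_enum 'I_(sr_n q)].

Definition to_sr l : simple_rep X :=
  @SimpleRep R X (size l) (fun i => (nth (set0, 0) l i).1) (fun i => (nth (set0, 0) l i).2).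

Lemma smeas_of_sr q : sr_measurable q -> smeas (of_sr q).
Proof. by move=> mq; apply: smeas_map => i; exact: mq. Qed.

Lemma sfun_of_sr q s : sfun (of_sr q) s = sr_fun q s.
Proof. by rewrite /sfun big_map. Qed.

Lemma sint_of_sr D q : sint D (of_sr q) = sr_integral D q.
Proof. by rewrite /sint big_map. Qed.

Lemma measurable_to_sr l : smeas l -> sr_measurable (to_sr l).
Proof.
move=> ml [i il] /=; elim: l ml i il => //= a l IH [ma ml] [|i] //= il.
exact: IH.
Qed.

Lemma sfun_to_sr l s : sr_fun (to_sr l) s = sfun l s.
Proof. by rewrite /sfun /sr_fun /= (big_nth (set0, 0)) big_mkord. Qed.

Lemma sint_to_sr D l : sr_integral D (to_sr l) = sint D l.
Proof. by rewrite /sint /sr_integral /= (big_nth (set0, 0)) big_mkord. Qed.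

Definition ssub l1 l2 := l1 ++ smap (fun x => (-1) *: x) l2.

Lemma smeas_ssub l1 l2 : smeas l1 -> smeas l2 -> smeas (ssub l1 l2).
Proof. by move=> m1 m2; apply: smeas_cat => //; exact: smeas_smap. Qed.

Lemma sfun_ssub l1 l2 s : sfun (ssub l1 l2) s = sfun l1 s - sfun l2 s.
Proof. by rewrite sfun_cat sfun_smap ?scaleN1r//; exact: scalelin. Qed.

Lemma sint_ssub D l1 l2 : sint D (ssub l1 l2) = sint D l1 - sint D l2.
Proof. by rewrite sint_cat sint_smap ?scaleN1r//; exact: scalelin. Qed.

Definition dist1 D f g : \bar R := (\int[mu]_(s in D) (`|f s - g s|)%:E)%E.

Lemma dist1_ge0 D f g : (0 <= dist1 D f g)%E.
Proof. by apply: integral_ge0 => s _; rewrite lee_fin. Qed.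
Hint Resolve dist1_ge0 : core.

(** Convergence is asked at every point of [D], so that measurability passes to the limit;
    [bochner_clean] provides it after a change on a null set. *)
Definition goodseq D f r : Prop :=
  [/\ forall k, smeas (r k),
      forall s, D s -> (fun k => sfun (r k) s) @ \oo --> f s &
      tends0 (fun k => dist1 D (sfun (r k)) f)].

(** Along simple functions [N s] is measurable by [measurable_sfun_comp], and continuity of [N s]
    passes this to the pointwise limit. *)
Lemma good_measurable (N : R -> X -> R) D f r : measurable D ->
  (forall w, measurable_fun D (N ^~ w)) -> (forall s, D s -> continuous (N s)) ->
  (forall k, smeas (r k)) ->
  (forall s, D s -> (fun k => sfun (r k) s) @ \oo --> f s) ->
  measurable_fun D (fun s => N s (f s)).
Proof.
move=> mD mN cN mr rf.
apply: (@measurable_fun_cvg _ _ _ _ (fun k s => N s (sfun (r k) s))).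
  move=> k; rewrite (_ : (fun s => _) = fun s => N s (sfun (r k) s + 0)).
    exact: measurable_sfun_comp.
  by apply/funext => s; rewrite addr0.
by move=> s Ds; apply: continuous_cvg; [exact: cN|exact: rf].
Qed.

Lemma continuous_norm_sub (w : X) : continuous (fun u : X => `|w - u|).
Proof.
move=> u; apply: cvg_norm; apply: cvgB; [exact: cvg_cst|exact: cvg_id].
Qed.

Lemma good_measurable_sub D f l r : measurable D -> smeas l -> goodseq D f r ->
  measurable_fun D (fun s => `|sfun l s - f s|).
Proof.
move=> mD ml [mr rf _].
apply: (@good_measurable (fun s w => `|sfun l s - w|) D f r) => //.
  by move=> w; exact: measurable_norm_sfun.
by move=> s _; exact: continuous_norm_sub.
Qed.

Lemma measurable_dist1 D f l r : measurable D -> smeas l -> goodseq D f r ->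
  measurable_fun D (fun s => (`|sfun l s - f s|)%:E).
Proof. by move=> mD ml gf; apply/measurable_EFinP; exact: good_measurable_sub gf. Qed.

Lemma goodseq_sub D D' f r : measurable D -> measurable D' -> D' `<=` D ->
  goodseq D f r -> goodseq D' f r.
Proof.
move=> mD mD' DD gf; have [mr rf tr] := gf; split => //.
  by move=> s /DD; exact: rf.
apply: tends0_le tr => k; apply: ge0_subset_integral => //.
by apply: measurable_dist1 gf.
Qed.

(** Off [Z] both simple functions approximate the same value, so the triangle inequality bounds
    their difference by the sum of the two errors. *)
Lemma le_sint_dist (p : X -> R) C D Z f g l1 l2 : seminorm p -> 0 <= C ->
  (forall u, p u <= C * `|u|) -> measurable D -> (mu D < +oo)%E ->
  smeas l1 -> smeas l2 ->
  measurable_fun D (fun s => (`|sfun l1 s - f s|)%:E) ->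
  measurable_fun D (fun s => (`|sfun l2 s - g s|)%:E) ->
  measurable Z -> mu Z = 0%E -> (forall s, D s -> ~ Z s -> f s = g s) ->
  ((p (sint D l1 - sint D l2))%:E <=
    C%:E * (dist1 D (sfun l1) f + dist1 D (sfun l2) g))%E.
Proof.
move=> sp C0 pC mD fD m1 m2 mf mg mZ Z0 fg.
rewrite -sint_ssub; apply: le_trans (le_sint sp (smeas_ssub m1 m2) mD fD) _.
have e0 u : (0 <= (`|u : X|)%:E)%E by rewrite lee_fin.
rewrite /dist1 -ge0_integralD// -ge0_integralZl//; last 2 first.
  exact: emeasurable_funD.
  by move=> s _; rewrite adde_ge0.
apply: (@le_integral_ge0_null _ _ R mu _ _ _ _ mD mZ Z0).
- by move=> s _; rewrite lee_fin seminorm_ge0.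
- by move=> s _; rewrite mule_ge0// ?lee_fin// addr_ge0.
- by apply: measurable_funeM; exact: emeasurable_funD.
move=> s Ds Zs; rewrite sfun_ssub -EFinD -EFinM lee_fin.
apply: le_trans (pC _) _; rewrite ler_wpM2l//.
rewrite (_ : sfun l1 s - _ = (sfun l1 s - f s) - (sfun l2 s - g s)).
  exact: ler_normB.
by rewrite -(fg s)// opprB addrA subrK.
Qed.

(** Two terms are compared through [f] by [le_sint_dist], so the integrals form a Cauchy sequence
    and completeness of [X] applies. *)
Lemma goodseq_cvg D f r : measurable D -> (mu D < +oo)%E -> goodseq D f r ->
  exists v : X, (fun k => sint D (r k)) @ \oo --> v.
Proof.
move=> mD fD gf; have [mr rf tr] := gf.
suff /cauchy_cvg/cvg_ex[v cv] : cauchy ((fun k => sint D (r k)) @ \oo) by exists v.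
apply: cauchy_exP => e e0; have e3 : 0 < e / 3 by rewrite divr_gt0.
have [k0 _ hk] := tr _ e3; exists (sint D (r k0)); exists k0 => // k kk /=.
rewrite -ball_normE /= -lte_fin.
have mr0 : measurable_fun D (fun s => (`|sfun (r k0) s - f s|)%:E).
  exact: measurable_dist1 gf.
have mrk : measurable_fun D (fun s => (`|sfun (r k) s - f s|)%:E).
  exact: measurable_dist1 gf.
apply: le_lt_trans (le_sint_dist (C := 1) seminorm_norm _ _ mD fD _ _ mr0 mrk
  measurable0 (measure0 _) _) _ => //.
  by move=> u; rewrite mul1r.
rewrite mul1e; apply: (@le_lt_trans _ _ (e / 3 + e / 3)%:E).
  by rewrite EFinD leeD//; apply: hk => /=.
by rewrite lte_fin; lra.
Qed.

(** Making [f] and its approximations vanish on [Z] and outside [D] turns almost everywhere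
    convergence into convergence on all of [D]; the integrals over [D] do not change because [Z] is
    null. *)
Lemma bochner_clean D f v : measurable D -> (mu D < +oo)%E ->
  bochner_integral D f v -> exists Z f' r,
    [/\ measurable Z, mu Z = 0%E,
        (forall s, f' s = (\1_(D `\` Z) s : R) *: f s),
        goodseq D f' r & (fun k => sint D (r k)) @ \oo --> v].
Proof.
move=> mD fD [q [mq [[Z [mZ Z0 aeZ]] [tq cq]]]].
have mDZ : measurable (D `\` Z) by exact: measurableD.
exists Z, (fun s => (\1_(D `\` Z) s : R) *: f s),
  (fun k => srestrict (D `\` Z) (of_sr (q k))); split => //.
- split.
  + by move=> k; apply: smeas_srestrict => //; exact: smeas_of_sr.
  + move=> s Ds; under eq_fun do rewrite sfun_srestrict sfun_of_sr.
    rewrite indicE; case: (boolP (s \in _)) => [|_]; last first.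
      by under eq_fun do rewrite scale0r; rewrite scale0r; exact: cvg_cst.
    rewrite inE => -[_ nZ]; under eq_fun do rewrite scale1r; rewrite scale1r.
    apply: contrapT => nc; apply: nZ; apply: aeZ => /= /(_ Ds).
    by move/nc.
  + have tq' : tends0 (fun k => dist1 D (sr_fun (q k)) f).
      by apply/tends0P => // k; exact: dist1_ge0.
    apply: tends0_le tq' => k; apply: le_integral_ge0 => s _; rewrite lee_fin//.
    rewrite sfun_srestrict sfun_of_sr -scalerBr normrZ indicE.
    by case: (_ \in _); rewrite ?normr1 ?mul1r// normr0 mul0r.
- rewrite (_ : (fun k => _) = (fun k => sr_integral D (q k)))//.
  apply/funext => k; rewrite -sint_of_sr /sint /srestrict big_map.
  elim: (of_sr (q k)) (smeas_of_sr (mq k)) => [|a l IH [ma ml]].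
    by rewrite !big_nil.
  rewrite !big_cons IH//; congr (_ *: _ + _) => /=.
  rewrite [RHS](fine_measure_split mD mZ ma fD) (_ : mu (a.1 `&` (D `&` Z)) = 0%E).
    rewrite add0r; congr (fine (mu _)); rewrite -setIA; congr (_ `&` _).
    by rewrite setIidl//; exact: subDsetl.
  apply: (subset_measure0 _ mZ _ Z0); last by move=> x [_ []].
  by do 2 apply: measurableI => //.
Qed.

Lemma bochner_unclean D Z f f' r v : measurable D -> measurable Z -> mu Z = 0%E ->
  (forall s, D s -> ~ Z s -> f' s = f s) -> goodseq D f' r ->
  (fun k => sint D (r k)) @ \oo --> v -> bochner_integral D f v.
Proof.
move=> mD mZ Z0 ff gf cv; have [mr rf tr] := gf.
exists (fun k => to_sr (r k)); split; first by move=> k; exact: measurable_to_sr.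
split.
  exists Z; split => // s /= ns; apply: contrapT => nZ; apply: ns => Ds.
  under eq_fun do rewrite sfun_to_sr.
  by rewrite -ff//; exact: rf.
split; last by under eq_fun do rewrite sint_to_sr.
apply/tends0P; first by move=> k; exact: dist1_ge0.
apply: tends0_le tr => k; apply: (@le_integral_ge0_null _ _ R mu _ _ _ _ mD mZ Z0) => //.
- exact: measurable_dist1 gf.
- by move=> s Ds nZ; rewrite sfun_to_sr ff.
Qed.

Lemma bochner_good D f r : measurable D -> (mu D < +oo)%E -> goodseq D f r ->
  exists2 v : X, bochner_integral D f v & (fun k => sint D (r k)) @ \oo --> v.
Proof.
move=> mD fD gf; have [v cv] := goodseq_cvg mD fD gf; exists v => //.
by apply: (bochner_unclean (f' := f) mD measurable0 _ _ gf cv).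
Qed.

(** One estimate with three uses: [D'] empty gives the norm inequality, [D' = D] gives uniqueness,
    and the intervals [[1, r]] and [[1, t]] give the tail estimate [Lam_tail]. A general seminorm
    [p] allows [p = N t]. *)
Lemma bochner_le_diff (p : X -> R) C D D' Z f g (h : R -> R) v v' :
  seminorm p -> 0 <= C -> (forall u, p u <= C * `|u|) ->
  measurable D -> (mu D < +oo)%E -> measurable D' -> D' `<=` D ->
  measurable Z -> mu Z = 0%E ->
  bochner_integral D f v -> bochner_integral D' g v' ->
  (forall s, D' s -> ~ Z s -> f s = g s) ->
  measurable_fun (D `\` D') h -> (forall s, (D `\` D') s -> 0 <= h s) ->
  (forall s, (D `\` D') s -> ~ Z s -> p (f s) <= h s) ->
  ((p (v - v'))%:E <= \int[mu]_(s in D `\` D') (h s)%:E)%E.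
Proof.
move=> sp C0 pC mD fD mD' DD mZ Z0 bf bg fg mh h0 ph.
have fD' : (mu D' < +oo)%E.
  by apply: le_lt_trans fD; apply: le_measure; rewrite ?inE.
have mE : measurable (D `\` D') by exact: measurableD.
have fE : (mu (D `\` D') < +oo)%E.
  by apply: le_lt_trans fD; apply: le_measure; rewrite ?inE//; exact: subDsetl.
have [Z1 [f1 [r1 [mZ1 Z10 ff1 g1 c1]]]] := bochner_clean mD fD bf.
have [Z2 [f2 [r2 [mZ2 Z20 ff2 g2 c2]]]] := bochner_clean mD' fD' bg.
have [m1 _ t1] := g1; have [m2 _ t2] := g2.
pose W := Z `|` (Z1 `|` Z2).
have mW : measurable W by do 2 apply: measurableU => //.
have W0 : mu W = 0%E.
  by rewrite !null_set_setU//; exact: measurableU.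
have g1' := goodseq_sub mD mD' DD g1.
have g1E := goodseq_sub mD mE (@subDsetl _ _ _) g1.
have f1E s : D s -> ~ W s -> f1 s = f s.
  move=> Ds nW; rewrite ff1 indicE mem_set ?scale1r//; split => // Z1s.
  by apply: nW; right; left.
have f2E s : D' s -> ~ W s -> f2 s = g s.
  move=> Ds nW; rewrite ff2 indicE mem_set ?scale1r//; split => // Z1s.
  by apply: nW; right; right.
apply/lee_addgt0Pr => e e0.
(* Five errors of size [C * e'] will add up: one for [v], one for [v'], two on [D'] and one on the
   complement of [D'] in [D]. *)
have C1 : 0 < C * 5 + 1 by rewrite ltr_wpDl// mulr_ge0.
pose e' := e / (C * 5 + 1); have e'0 : 0 < e' by rewrite divr_gt0.
have eE : C * 5 * e' <= e.
  by rewrite mulrCA ler_piMr ?(ltW e0)// ler_pdivrMr//; lra.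
have [k [k1 k2 k3 k4]] : exists k, [/\ `|v - sint D (r1 k)| <= e',
   `|v' - sint D' (r2 k)| <= e', (dist1 D (sfun (r1 k)) f1 <= e'%:E)%E
   & (dist1 D' (sfun (r2 k)) f2 <= e'%:E)%E].
  have n1 : \forall k \near \oo, `|v - sint D (r1 k)| <= e' by move/cvgrPdist_le : c1; exact.
  have n2 : \forall k \near \oo, `|v' - sint D' (r2 k)| <= e' by move/cvgrPdist_le : c2; exact.
  have n3 := t1 _ e'0; have n4 := t2 _ e'0.
  near \oo => k; exists k; split; near: k => //.
have d1' : (dist1 D' (sfun (r1 k)) f1 <= e'%:E)%E.
  apply: le_trans k3; apply: ge0_subset_integral => //; exact: measurable_dist1 g1.
have d1E : (dist1 (D `\` D') (sfun (r1 k)) f1 <= e'%:E)%E.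
  apply: le_trans k3; apply: ge0_subset_integral => //.
  exact: measurable_dist1 g1.
have tri (a b c : X) : p (a - c) <= p (a - b) + p (b - c).
  by rewrite -{1}(subrK b a) -addrA; exact: sp.1.
have s1 : ((p (sint D' (r1 k) - sint D' (r2 k)))%:E <= (C * (e' + e'))%:E)%E.
  apply: le_trans (le_sint_dist sp C0 pC mD' fD' (m1 k) (m2 k)
    (measurable_dist1 mD' (m1 k) g1') (measurable_dist1 mD' (m2 k) g2) mW W0 _) _.
    move=> s Ds nW; rewrite f2E// (f1E _ (DD _ Ds) nW).
    by apply: fg => // Zs; apply: nW; left.
  by rewrite EFinM lee_wpmul2l ?lee_fin// EFinD leeD.
have s2 : ((p (sint (D `\` D') (r1 k)))%:E <=
    (C * e')%:E + \int[mu]_(s in D `\` D') (h s)%:E)%E.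
  apply: le_trans (le_sint sp (m1 k) mE fE) _.
  have md : measurable_fun (D `\` D') (fun s => (`|sfun (r1 k) s - f1 s|)%:E).
    exact: measurable_dist1 g1E.
  have mhE : measurable_fun (D `\` D') (EFin \o h) by exact/measurable_EFinP.
  apply: (@le_trans _ _ (\int[mu]_(s in D `\` D')
      (C%:E * (`|sfun (r1 k) s - f1 s|)%:E + (h s)%:E))%E).
    apply: (@le_integral_ge0_null _ _ R mu _ _ _ _ mE mW W0).
    + by move=> s _; rewrite lee_fin seminorm_ge0.
    + by move=> s Es; rewrite -EFinM -EFinD lee_fin addr_ge0 ?mulr_ge0 ?h0.
    + by apply: emeasurable_funD => //; exact: measurable_funeM.
    + move=> s Es nW; rewrite -EFinM -EFinD lee_fin.
      rewrite -{1}(subrK (f1 s) (sfun (r1 k) s)); apply: le_trans (sp.1 _ _) _.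
      rewrite lerD// f1E; [|by case: Es|by []].
      by apply: ph => // Zs; apply: nW; left.
  rewrite ge0_integralD; [|by []| | | |by []]; first last.
  - by move=> s Es; rewrite lee_fin h0.
  - exact: measurable_funeM.
  - by move=> s _; rewrite -EFinM lee_fin mulr_ge0.
  rewrite ge0_integralZl//.
  by rewrite leeD2r// EFinM lee_wpmul2l ?lee_fin.
have splitD : sint D (r1 k) = sint D' (r1 k) + sint (D `\` D') (r1 k).
  by rewrite (sint_split mD mD' fD (m1 k)) (setIC D) setIidl.
apply: (@le_trans _ _ ((C * e' + (C * (e' + e') + C * e'))%:E +
   (p (sint (D `\` D') (r1 k)))%:E)%E).
  rewrite -EFinD lee_fin.
  have b1 := tri v (sint D (r1 k)) v'.
  have b2 := tri (sint D (r1 k)) (sint D' (r2 k)) v'.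
  have b3 : p (sint D (r1 k) - sint D' (r2 k)) <=
      p (sint D' (r1 k) - sint D' (r2 k)) + p (sint (D `\` D') (r1 k)).
    by rewrite splitD addrAC; exact: sp.1.
  have b4 : p (v - sint D (r1 k)) <= C * e'.
    by apply: le_trans (pC _) _; rewrite ler_wpM2l.
  have b5 : p (sint D' (r2 k) - v') <= C * e'.
    by apply: le_trans (pC _) _; rewrite ler_wpM2l// distrC.
  move: s1; rewrite lee_fin; lra.
apply: le_trans (leeD2l _ s2) _; rewrite addeA -EFinD addeC.
rewrite leeD2l// lee_fin; apply: le_trans eE; lra.
Unshelve. all: by end_near. Qed.

End bochner.
#[export] Hint Resolve dist1_ge0 : core.

(** * Norm inequality, uniqueness, linearity and dominated convergence *)

Section bochner_theory.
Context {R : realType} {X : completeNormedModType R}.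
Local Notation mu := (@lebesgue_measure R).
Implicit Types (l : seq (set R * X)) (D A Z : set R) (f g : R -> X)
  (r : nat -> seq (set R * X)).

Lemma bochner_set0 f : bochner_integral set0 f 0.
Proof.
apply: (@bochner_unclean _ _ set0 set0 f f (fun=> [::]) 0) => //.
- split => // e e0; apply: nearW => k.
  by rewrite /dist1 integral_set0 lee_fin ltW.
- rewrite (_ : (fun k => _) = fun=> 0); first exact: cvg_cst.
  by apply/funext => k; rewrite /sint big_nil.
Qed.

Lemma bochner_le (p : X -> R) C D Z f (h : R -> R) v :
  seminorm p -> 0 <= C -> (forall u, p u <= C * `|u|) ->
  measurable D -> (mu D < +oo)%E -> measurable Z -> mu Z = 0%E ->
  bochner_integral D f v ->
  measurable_fun D h -> (forall s, D s -> 0 <= h s) ->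
  (forall s, D s -> ~ Z s -> p (f s) <= h s) ->
  ((p v)%:E <= \int[mu]_(s in D) (h s)%:E)%E.
Proof.
move=> sp C0 pC mD fD mZ Z0 bf mh h0 ph.
have := @bochner_le_diff _ _ p C D set0 Z f f h v 0 sp C0 pC mD fD measurable0
  (@sub0set _ _) mZ Z0 bf (bochner_set0 f).
by rewrite setD0 subr0; apply.
Qed.

Lemma bochner_unique D f v v' : measurable D -> (mu D < +oo)%E ->
  bochner_integral D f v -> bochner_integral D f v' -> v = v'.
Proof.
move=> mD fD b1 b2.
have := @bochner_le_diff _ _ _ 1 D D set0 f f (fun=> 0) v v' (@seminorm_norm R X) ler01
  _ mD fD mD (fun _ => id) measurable0 (measure0 _) b1 b2.
rewrite setDv integral_set0 lee_fin normr_le0 subr_eq0 => H; apply/eqP; apply: H => //.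
by move=> u; rewrite mul1r.
Qed.

Lemma goodseq_lin D (c : R) f g r r' : measurable D ->
  goodseq D f r -> goodseq D g r' ->
  goodseq D (fun s => f s + c *: g s) (fun k => r k ++ smap (fun x => c *: x) (r' k)).
Proof.
move=> mD gf gg; have [m1 c1 t1] := gf; have [m2 c2 t2] := gg; split.
- by move=> k; apply: smeas_cat => //; exact: smeas_smap.
- move=> s Ds; under eq_fun do rewrite sfun_cat (sfun_smap _ _ (scalelin c)).
  apply: cvgD; first exact: c1.
  by apply: cvgZr; exact: c2.
- apply: (@tends0_le _ _ (fun k => dist1 D (sfun (r k)) f +
     (`|c|)%:E * dist1 D (sfun (r' k)) g)%E); last first.
    by apply: tends0D => //; apply: tends0Z.
  move=> k; rewrite /dist1.
  have md1 := measurable_dist1 mD (m1 k) gf.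
  have md2 := measurable_dist1 mD (m2 k) gg.
  rewrite -ge0_integralZl ?lee_fin//.
  rewrite -ge0_integralD; [|by []| | | |]; first last.
  + exact: measurable_funeM.
  + by move=> s _; rewrite -EFinM lee_fin mulr_ge0.
  + by [].
  + by move=> s _; rewrite lee_fin.
  apply: le_integral_ge0 => s _; first by rewrite lee_fin.
  rewrite -EFinM -EFinD lee_fin sfun_cat (sfun_smap _ _ (scalelin c)).
  by rewrite opprD addrACA -scalerBr -normrZ ler_normD.
Qed.

Lemma bochner_lin D (c : R) f g v w : measurable D -> (mu D < +oo)%E ->
  bochner_integral D f v -> bochner_integral D g w ->
  bochner_integral D (fun s => f s + c *: g s) (v + c *: w).
Proof.
move=> mD fD /(bochner_clean mD fD)[Z1 [f1 [r1 [mZ1 Z10 ff1 g1 c1]]]].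
move=> /(bochner_clean mD fD)[Z2 [f2 [r2 [mZ2 Z20 ff2 g2 c2]]]].
apply: (@bochner_unclean _ _ D (Z1 `|` Z2) _ _ _ _ mD _ _ _ (goodseq_lin c mD g1 g2)).
- exact: measurableU.
- by rewrite null_set_setU.
- move=> s Ds nZ; rewrite ff1 ff2 !indicE !mem_set ?scale1r//.
    by split => // Zs; apply: nZ; right.
  by split => // Zs; apply: nZ; left.
- under eq_fun do rewrite sint_cat (sint_smap _ _ (scalelin c)).
  by apply: cvgD => //; exact: cvgZr.
Qed.

Lemma bochner_map D (F : X -> X) f v : measurable D -> (mu D < +oo)%E ->
  bounded_linear F -> bochner_integral D f v -> bochner_integral D (F \o f) (F v).
Proof.
move=> mD fD [FL [K0 FK0]] /(bochner_clean mD fD)[Z [f1 [r [mZ Z0 ff g1 c1]]]].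
(* The constant in [bounded_linear] has no prescribed sign, hence the absolute value. *)
pose K := `|K0|; have K0' : 0 <= K by exact: normr_ge0.
have FK u : `|F u| <= K * `|u|.
  by apply: le_trans (FK0 u) _; rewrite ler_wpM2r// ler_norm.
have FB u w : F u - F w = F (u - w).
  by rewrite -scaleN1r addrC -FL scaleN1r addrC.
have cF (u : nat -> X) x : u @ \oo --> x -> F \o u @ \oo --> F x.
  move=> /cvgrPdist_le cu; apply/cvgrPdist_le => e e0.
  have K1 : 0 < K + 1 by rewrite ltr_wpDl.
  have eK : 0 < e / (K + 1) by rewrite divr_gt0.
  near=> k; rewrite /= FB; apply: le_trans (FK _) _.
  apply: (@le_trans _ _ (K * (e / (K + 1)))).
    by rewrite ler_wpM2l//; near: k; exact: cu.
  by rewrite mulrCA ler_piMr ?(ltW e0)// ler_pdivrMr//; lra.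
have [m1 cc t1] := g1.
apply: (@bochner_unclean _ _ D Z _ (F \o f1) (fun k => smap F (r k))) => //.
- by move=> s Ds nZ /=; rewrite ff indicE mem_set ?scale1r.
- split.
  + by move=> k; exact: smeas_smap.
  + by move=> s Ds; under eq_fun do rewrite sfun_smap//; apply: cF; exact: cc.
  + apply: (@tends0_le _ _ (fun k => K%:E * dist1 D (sfun (r k)) f1)%E); last first.
      exact: tends0Z.
    move=> k; have md1 := measurable_dist1 mD (m1 k) g1.
    rewrite /dist1 -ge0_integralZl ?lee_fin//.
    apply: le_integral_ge0 => s _; first by rewrite lee_fin.
    by rewrite -EFinM lee_fin sfun_smap// FB.
- by under eq_fun do rewrite sint_smap//; exact: cF.
Unshelve. all: by end_near. Qed.

Lemma bochner_simple l D : measurable D -> (mu D < +oo)%E -> smeas l ->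
  bochner_integral D (sfun l) (sint D l).
Proof.
move=> mD fD ml.
apply: (@bochner_unclean _ _ D set0 _ (sfun l) (fun=> l)) => //.
- split => //; first by move=> s _; exact: cvg_cst.
  move=> e e0; apply: nearW => _; rewrite /dist1.
  under eq_integral do rewrite subrr normr0.
  by rewrite integral0 lee_fin ltW.
- exact: cvg_cst.
Qed.

Lemma bochner_eq D f g v : measurable D -> (mu D < +oo)%E ->
  (forall s, D s -> f s = g s) -> bochner_integral D f v -> bochner_integral D g v.
Proof.
move=> mD fD fg /(bochner_clean mD fD)[Z [f1 [r [mZ Z0 ff g1 c1]]]].
apply: (@bochner_unclean _ _ D Z _ f1 r) => // s Ds nZ.
by rewrite ff indicE mem_set ?scale1r ?fg.
Qed.

Lemma tends0_dominated (q : nat -> R -> R) (g : R -> R) D : measurable D ->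
  (forall k, measurable_fun D (q k)) -> measurable_fun D g ->
  (forall k s, D s -> 0 <= q k s <= g s) ->
  (forall s, D s -> q ^~ s @ \oo --> (0 : R)) ->
  (\int[mu]_(s in D) (g s)%:E < +oo)%E ->
  tends0 (fun k => \int[mu]_(s in D) (q k s)%:E)%E.
Proof.
move=> mD mq mg qg q0 ig; have g0 s : D s -> 0 <= g s.
  by move=> Ds; have /andP[a b] := qg 0%N s Ds; exact: le_trans b.
apply/tends0P.
  by move=> k; apply: integral_ge0 => s Ds; rewrite lee_fin; have /andP[] := qg k s Ds.
have := @dominated_cvg _ _ R mu D mD (fun k s => (q k s)%:E) (fun=> 0%E)
  (fun s => (g s)%:E).
rewrite integral0; apply => //.
- by move=> k; apply/measurable_EFinP; exact: mq.
- by move=> s Ds; apply: cvg_EFin; [exact: nearW|exact: q0].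
- apply/integrableP; split; first exact/measurable_EFinP.
  under eq_integral => s Ds.
    rewrite gee0_abs; last by rewrite lee_fin g0//; exact: set_mem.
    over.
  by [].
- move=> k s Ds; have /andP[a b] := qg k s Ds.
  by rewrite gee0_abs ?lee_fin.
Qed.

End bochner_theory.

(** * Approximation of right-continuous functions *)

Section grid.
Context {R : realType} {X : completeNormedModType R}.
Local Notation mu := (@lebesgue_measure R).
Implicit Types (b s : R) (k n i : nat) (A : set R) (F : R -> X).

(** Right-continuity on [[1, b]] suffices for sampling at nodes to the right, and it admits the
    jumps of the test functions used for the converse. *)
Definition rcont b (F : R -> X) : Prop := forall s, 1 <= s -> s <= b ->
  forall e, 0 < e -> exists2 d, 0 < d &
    forall u, s <= u -> u <= b -> u < s + d -> `|F u - F s| <= e.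

(** The right end of the [i]-th cell of mesh [1 / k.+1], capped at [b] because [F] is controlled
    only up to [b]. *)
Definition node b k i : R := Num.min b (i.+1%:R / k.+1%:R).

Definition grid b k s : R := node b k (Num.truncn (s * k.+1%:R)).

(** The cells cover [[0, b]] because [b < (Num.truncn b).+1]. The set [A] is there for [oplist],
    where it carries one vector of a simple function. *)
Definition glist b k A F : seq (set R * X) :=
  [seq (`[i%:R / k.+1%:R, i.+1%:R / k.+1%:R[%classic `&` A, F (node b k i))
  | i <- iota 0 ((Num.truncn b).+1 * k.+1)].

Lemma smeas_glist b k A F : measurable A -> smeas (glist b k A F).
Proof. by move=> mA; apply: smeas_map => i /=; exact: measurableI. Qed.

Lemma truncn_cell k s i : 0 <= s ->
  (s \in `[i%:R / k.+1%:R, i.+1%:R / k.+1%:R[) = (Num.truncn (s * k.+1%:R) == i).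
Proof.
move=> s0; have sk : 0 <= s * k.+1%:R by rewrite mulr_ge0.
rewrite in_itv /= ler_pdivrMr// ltr_pdivlMr// truncn_eq//.
Qed.

Lemma sfun_glist b k A F s : 0 <= s -> s <= b ->
  sfun (glist b k A F) s = (\1_A s : R) *: F (grid b k s).
Proof.
move=> s0 sb; have sk : 0 <= s * k.+1%:R by rewrite mulr_ge0.
have tm : Num.truncn (s * k.+1%:R) \in iota 0 ((Num.truncn b).+1 * k.+1).
  rewrite mem_iota add0n /= -(ltr_nat R) natrM.
  have /andP[h1 _] := truncn_itv sk; apply: le_lt_trans h1 _.
  rewrite ltr_pM2r// (le_lt_trans sb)//.
  by have /andP[] := truncn_itv (le_trans s0 sb).
rewrite /sfun /glist big_map (bigD1_seq _ tm (iota_uniq _ _)) /=.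
rewrite big1 ?addr0 => [|i iN].
  rewrite indicI /= [X in X * _](_ : _ = 1) ?mul1r//.
  by rewrite indicE mem_set//= truncn_cell.
rewrite indicI /= [X in X * _](_ : _ = 0) ?mul0r ?scale0r//.
by rewrite indicE memNset//= truncn_cell// eq_sym; exact/negP.
Qed.

Lemma grid_ge b k s : 0 <= s -> s <= b -> s <= grid b k s.
Proof.
move=> s0 sb; have sk : 0 <= s * k.+1%:R by rewrite mulr_ge0.
rewrite /grid /node le_min sb /= ler_pdivlMr//.
by have /andP[_ /ltW] := truncn_itv sk.
Qed.

Lemma grid_le b k s : grid b k s <= b.
Proof. by rewrite /grid /node ge_min lexx. Qed.

Lemma grid_lt b k s d : 0 <= s -> k.+1%:R^-1 < d -> grid b k s < s + d.
Proof.
move=> s0 kd; have sk : 0 <= s * k.+1%:R by rewrite mulr_ge0.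
apply: (@le_lt_trans _ _ (s + k.+1%:R^-1)); last by rewrite ltrD2l.
rewrite /grid /node ge_min; apply/orP; right.
rewrite ler_pdivrMr// mulrDl mulVf// -natr1 lerD2r.
by have /andP[] := truncn_itv sk.
Qed.

Lemma grid_cvg b F s : rcont b F -> 1 <= s -> s <= b ->
  (fun k => F (grid b k s)) @ \oo --> F s.
Proof.
move=> rF s1 sb; have s0 : 0 <= s by rewrite (le_trans ler01).
apply/cvgrPdist_le => e e0; have [d d0 dF] := rF s s1 sb e e0.
near=> k; rewrite distrC; apply: dF; [exact: grid_ge|exact: grid_le|].
by apply: grid_lt => //; near: k; exact: (near_infty_natSinv_lt (PosNum d0)).
Unshelve. all: by end_near. Qed.

Lemma itv_measure b : 1 <= b -> mu `[1, b] = (b - 1)%:E.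
Proof.
move=> b1; rewrite lebesgue_measure_itv /= lte_fin.
by case: ltP => // b1'; have -> : b = 1 by [apply/le_anti; rewrite b1 b1']; rewrite subrr.
Qed.

Lemma itv_measure_fin b c : (mu `[b, c] < +oo)%E.
Proof. by rewrite lebesgue_measure_itv /=; case: ifP => _; rewrite ltry. Qed.

(** Grid samples converge pointwise by right-continuity, and the error is dominated by the constant
    [C + C]. *)
Lemma goodseq_rcont b C F : 1 <= b -> rcont b F ->
  (forall s, 1 <= s -> s <= b -> `|F s| <= C) ->
  goodseq `[1, b] F (fun k => glist b k setT F).
Proof.
move=> b1 rF FC; have D01 s : `[1, b]%classic s -> [/\ 0 <= s, 1 <= s & s <= b].
  by rewrite /= in_itv /= => /andP[s1 sb]; split => //; rewrite (le_trans ler01).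
have mD : measurable `[1, b]%classic by exact: measurable_itv.
have mr k : smeas (glist b k setT F) by exact: smeas_glist.
have gE k s : `[1, b]%classic s -> sfun (glist b k setT F) s = F (grid b k s).
  by move=> /D01[s0 s1 sb]; rewrite sfun_glist// indicT scale1r.
have cr s : `[1, b]%classic s -> (fun k => sfun (glist b k setT F) s) @ \oo --> F s.
  move=> Ds; under eq_fun do rewrite gE//.
  by have [s0 s1 sb] := D01 _ Ds; exact: grid_cvg.
split => //; apply: (@tends0_dominated _ _ (fun=> C + C)) => //.
- move=> k; apply: (@good_measurable _ _ (fun s w => `|sfun (glist b k setT F) s - w|)
    _ _ (fun k => glist b k setT F)) => //.
  + by move=> w; exact: measurable_norm_sfun.
  + by move=> s _; exact: continuous_norm_sub.
- move=> k s Ds; rewrite normr_ge0 /= gE//; have [s0 s1 sb] := D01 _ Ds.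
  apply: le_trans (ler_normB _ _) _; rewrite lerD ?FC//; last exact: grid_le.
  by rewrite (le_trans s1)// grid_ge.
- move=> s Ds; apply/norm_cvg0P.
  by apply/subr_cvg0; exact: cr.
- rewrite (integral_cst mu mD (C + C)%:E).
  by rewrite [X in (_ * X)%E](itv_measure b1) -EFinM ltry.
Qed.

(** The operator is frozen on each grid cell at the value of [S] at the node, so that its action on
    a simple function is again a simple function. *)
Definition oplist b k (S : R -> X -> X) (l : seq (set R * X)) :=
  flatten [seq glist b k a.1 (S ^~ a.2) | a <- l].

Lemma smeas_oplist b k S l : smeas l -> smeas (oplist b k S l).
Proof.
elim: l => [//|a l IH [ma ml]].
by apply: (@smeas_cat _ _ (glist b k a.1 (S ^~ a.2)) (oplist b k S l));
  [exact: smeas_glist|exact: IH].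
Qed.

Lemma sfun_oplist b k S l s : 0 <= s -> s <= b ->
  (forall (c : R) u v, S (grid b k s) (c *: u + v) =
     c *: S (grid b k s) u + S (grid b k s) v) ->
  sfun (oplist b k S l) s = S (grid b k s) (sfun l s).
Proof.
move=> s0 sb SL; rewrite {2}/sfun linear_big//; elim: l => [|a l IH].
  by rewrite /sfun !big_nil.
rewrite (_ : oplist b k S (a :: l) = glist b k a.1 (S ^~ a.2) ++ oplist b k S l)//.
by rewrite sfun_cat big_cons sfun_glist// -IH.
Qed.

Lemma integral_norm_good D (y : R -> X) r : measurable D -> (mu D < +oo)%E ->
  goodseq D y r -> (\int[mu]_(s in D) (`|y s|)%:E < +oo)%E.
Proof.
move=> mD fD gy; have [mr _ ty] := gy.
have [k0 _ /(_ k0 (leqnn _)) /= hk] := ty 1 ltr01.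
have [C C0 hC] := sfun_bounded (r k0).
have md := measurable_dist1 mD (mr k0) gy.
apply: (@le_lt_trans _ _ (\int[mu]_(s in D) (C%:E + (`|sfun (r k0) s - y s|)%:E))%E).
  apply: le_integral_ge0 => s _; first by rewrite lee_fin.
  rewrite -EFinD lee_fin -{1}(subrK (sfun (r k0) s) (y s)) addrC.
  by apply: le_trans (ler_normD _ _) _; rewrite lerD// distrC.
rewrite ge0_integralD// (integral_cst mu mD C%:E) lte_add_pinfty//.
  by rewrite lte_mul_pinfty// lee_fin.
by apply: le_lt_trans hk _; rewrite ltry.
Qed.

(** In mean, [y] is within [e / 2] of a simple function bounded by [C], whose mass on a set of
    measure at most [d] is at most [C * d]. *)
Lemma integral_norm_abs_cont D (y : R -> X) r : measurable D ->
  goodseq D y r -> forall e : R, 0 < e -> exists2 d : R, 0 < d &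
    forall E, measurable E -> E `<=` D -> (mu E <= d%:E)%E ->
    (\int[mu]_(s in E) (`|y s|)%:E <= e%:E)%E.
Proof.
move=> mD gy e e0; have [mr _ ty] := gy.
have e2 : 0 < e / 2 by rewrite divr_gt0.
have [k0 _ /(_ k0 (leqnn _)) /= hk] := ty _ e2.
have [C C0 hC] := sfun_bounded (r k0).
have C1 : 0 < C + 1 by rewrite ltr_wpDl.
exists (e / 2 / (C + 1)) => [|E mE ED Ed]; first by rewrite divr_gt0.
have md := measurable_dist1 mE (mr k0) (goodseq_sub mD mE ED gy).
apply: (@le_trans _ _ (\int[mu]_(s in E) (C%:E + (`|sfun (r k0) s - y s|)%:E))%E).
  apply: le_integral_ge0 => s _; first by rewrite lee_fin.
  rewrite -EFinD lee_fin -{1}(subrK (sfun (r k0) s) (y s)) addrC.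
  by apply: le_trans (ler_normD _ _) _; rewrite lerD// distrC.
rewrite ge0_integralD// (integral_cst mu mE C%:E) [e]splitr EFinD leeD//.
  apply: (@le_trans _ _ (C%:E * (e / 2 / (C + 1))%:E)%E).
    by rewrite lee_wpmul2l ?lee_fin.
  by rewrite -EFinM lee_fin mulrCA ler_piMr ?(ltW e2)// ler_pdivrMr//; lra.
apply: le_trans hk; apply: ge0_subset_integral => //.
exact: (measurable_dist1 mD (mr k0) gy).
Qed.

(* On a fixed vector [y s] the discretised operators converge to [S s] because of
   right continuity; uniform boundedness absorbs the error of the simple
   approximations of [y]. *)
Lemma goodseq_op b K (S : R -> X -> X) (y : R -> X) r : 1 <= b -> 0 <= K ->
  (forall s, 1 <= s -> s <= b -> forall (c : R) u v,
     S s (c *: u + v) = c *: S s u + S s v) ->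
  (forall s, 1 <= s -> s <= b -> forall u, `|S s u| <= K * `|u|) ->
  (forall u, rcont b (S ^~ u)) ->
  goodseq `[1, b] y r ->
  goodseq `[1, b] (fun s => S s (y s)) (fun k => oplist b k S (r k)).
Proof.
move=> b1 K0 SL SK Sr gy; have [mr cr tr] := gy.
have D01 s : `[1, b]%classic s -> [/\ 0 <= s, 1 <= s & s <= b].
  by rewrite /= in_itv /= => /andP[s1 sb]; split => //; rewrite (le_trans ler01).
have mD : measurable `[1, b]%classic by exact: measurable_itv.
have mo k : smeas (oplist b k S (r k)) by exact: smeas_oplist.
have g1 k s : `[1, b]%classic s -> 1 <= grid b k s <= b.
  by move=> /D01[s0 s1 sb]; rewrite grid_le (le_trans s1)// grid_ge.
have SB s u v : 1 <= s -> s <= b -> S s u - S s v = S s (u - v).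
  by move=> s1 sb; rewrite -scaleN1r addrC -SL// scaleN1r addrC.
have oE k l s : `[1, b]%classic s -> sfun (oplist b k S l) s = S (grid b k s) (sfun l s).
  move=> Ds; have [s0 s1 sb] := D01 _ Ds; rewrite sfun_oplist//.
  by have /andP[? ?] := g1 k s Ds; exact: SL.
have sc s : `[1, b]%classic s -> continuous (S s).
  move=> Ds u; have [s0 s1 sb] := D01 _ Ds; apply/cvgrPdist_le => e e0.
  have K1 : 0 < K + 1 by rewrite ltr_wpDl.
  have eK : 0 < e / (K + 1) by rewrite divr_gt0.
  near=> w; rewrite SB//; apply: le_trans (SK _ _ _ _) _ => //.
  apply: (@le_trans _ _ (K * (e / (K + 1)))).
    by rewrite ler_wpM2l//; near: w; exact: cvgr_dist_le.
  by rewrite mulrCA ler_piMr ?(ltW e0)// ler_pdivrMr//; lra.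
have q0 s : `[1, b]%classic s ->
    (fun k => `|S (grid b k s) (y s) - S s (y s)|) @ \oo --> (0 : R).
  move=> Ds; have [s0 s1 sb] := D01 _ Ds; apply/norm_cvg0P.
  by apply/subr_cvg0; apply: (grid_cvg (F := S ^~ (y s))).
have le2 k s : `[1, b]%classic s -> `|sfun (oplist b k S (r k)) s - S s (y s)| <=
    `|S (grid b k s) (y s) - S s (y s)| + K * `|sfun (r k) s - y s|.
  move=> Ds; have /andP[? ?] := g1 k s Ds.
  rewrite oE// -{1}(subrK (S (grid b k s) (y s)) (S (grid b k s) _)) -addrA addrC.
  by apply: le_trans (ler_normD _ _) _; rewrite lerD2l SB// SK.
have co s : `[1, b]%classic s ->
    (fun k => sfun (oplist b k S (r k)) s) @ \oo --> S s (y s).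
  move=> Ds; apply/subr_cvg0; apply/norm_cvg0P.
  apply: (@squeeze_cvgr _ _ _ _ (fun=> 0) (fun k =>
    `|S (grid b k s) (y s) - S s (y s)| + K * `|sfun (r k) s - y s|)).
  - by apply: nearW => k; rewrite normr_ge0 le2.
  - exact: cvg_cst.
  - rewrite -[X in _ --> X]addr0 -[X in _ --> _ + X](mulr0 K).
    apply: cvgD; first exact: q0.
    apply: cvgMr; apply/norm_cvg0P; apply/subr_cvg0; exact: cr.
have mz l : smeas l -> measurable_fun `[1, b]%classic (fun s => `|sfun l s - S s (y s)|).
  move=> ml; apply: (@good_measurable _ _ (fun s w => `|sfun l s - w|)
    _ _ (fun k => oplist b k S (r k))) => //.
  + by move=> w; exact: measurable_norm_sfun.
  + by move=> s _; exact: continuous_norm_sub.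
have my : measurable_fun `[1, b]%classic (fun s => `|y s|).
  apply: (@good_measurable _ _ (fun s w => `|w|) _ _ r) => //.
  by move=> s _ u; exact: cvg_norm.
have mq k : measurable_fun `[1, b]%classic
    (fun s => `|S (grid b k s) (y s) - S s (y s)|).
  apply: (@good_measurable _ _ (fun s w => `|S (grid b k s) w - S s (y s)|) _ _ r) => //.
  (* For fixed [w], the sampled value [S (grid b k s) w] is that of [oplist] on the one-element list
     [[:: (setT, w)]], so [mz] applies. *)
  + move=> w; apply: (eq_measurable_fun
      (fun s => `|sfun (oplist b k S [:: (setT, w)]) s - S s (y s)|)); last first.
      by apply: mz; apply: smeas_oplist; split => //; exact: measurableT.
    move=> s /set_mem Ds; rewrite oE// /sfun big_cons big_nil indicT scale1r addr0//.
  + move=> s Ds w; apply: cvg_norm; apply: cvgB; last exact: cvg_cst.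
    by apply: sc; rewrite /= in_itv /=; exact: g1.
split => //.
pose D : set R := `[1, b]%classic.
pose I k := (\int[mu]_(s in D) (`|S (grid b k s) (y s) - S s (y s)|)%:E)%E.
apply: (@tends0_le _ _ (fun k => I k + K%:E * dist1 D (sfun (r k)) y)%E).
  move=> k; have md1 := measurable_dist1 mD (mr k) gy.
  rewrite /I /dist1 -ge0_integralZl ?lee_fin//.
  rewrite -ge0_integralD; [|by []| | | |]; first last.
  + exact: measurable_funeM.
  + by move=> s _; rewrite -EFinM lee_fin mulr_ge0.
  + by apply/measurable_EFinP; exact: mq.
  + by move=> s _; rewrite lee_fin.
  apply: le_integral_ge0 => s Ds; first by rewrite lee_fin.
  by rewrite -EFinM -EFinD lee_fin le2.
apply: tends0D; last exact: tends0Z.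
apply: (@tends0_dominated _ _ (fun s => (K + K) * `|y s|)) => //.
- exact: measurable_funM.
- move=> k s Ds; rewrite normr_ge0 /=; have [s0 s1 sb] := D01 _ Ds.
  have /andP[? ?] := g1 k s Ds.
  apply: le_trans (ler_normB _ _) _; rewrite mulrDl.
  by rewrite lerD// SK.
- under eq_integral do rewrite EFinM.
  rewrite ge0_integralZl ?lee_fin ?addr_ge0//; last by apply/measurable_EFinP; exact: my.
  rewrite lte_mul_pinfty ?lee_fin ?addr_ge0//.
  exact: (integral_norm_good mD (itv_measure_fin _ _) gy).
Unshelve. all: by end_near. Qed.

End grid.

(** * A weighted convolution estimate *)

Section scalar.
Context {R : realType}.
Local Notation mu := (@lebesgue_measure R).

Lemma integral_itv_split (f : R -> R) (a c b : R) :
  measurable_fun setT f -> (forall s, 0 <= f s) ->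
  (\int[mu]_(s in `[a, b]) (f s)%:E <=
   \int[mu]_(s in `[a, c]) (f s)%:E + \int[mu]_(s in `[c, b]) (f s)%:E)%E.
Proof.
move=> mf f0; have mfE D : measurable D -> measurable_fun D (fun s => (f s)%:E).
  by move=> mD; apply/measurable_EFinP; exact: measurable_funTS.
have e0 s : (0 <= (f s)%:E)%E by rewrite lee_fin.
have mB : measurable (`[c, b]%classic `\` `[a, c]%classic).
  by apply: measurableD; exact: measurable_itv.
apply: (@le_trans _ _
  (\int[mu]_(s in `[a, c] `|` (`[c, b] `\` `[a, c])) (f s)%:E)%E).
  apply: ge0_subset_integral => //.
  - by apply: measurableU.
  - by apply: mfE; exact: measurableU.
  - move=> s; rewrite /= !in_itv /= => /andP[s1 s2].
    case: (leP s c) => sc; [by left; rewrite s1|right; split].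
      by rewrite (ltW sc).
    by rewrite andbF.
rewrite ge0_integral_setU//.
- rewrite leeD2l//; apply: ge0_subset_integral => //.
  exact: mfE.
- by apply: mfE; exact: measurableU.
- by apply/disj_setPS => s /= [? []].
Qed.

Variables (n : R -> R) (m : R).
Hypotheses (mn : measurable_fun setT n) (n0 : forall s, 0 <= n s).
Hypothesis nm : forall u : R, 1 <= u -> (\int[mu]_(s in `[u, (u + 1)%R]) (n s)%:E <= m%:E)%E.

Let m0 : 0 <= m.
Proof.
rewrite -lee_fin; apply: le_trans (nm (lexx 1)).
by apply: integral_ge0 => s _; rewrite lee_fin.
Qed.

Lemma integral_itv_nat (k : nat) (u : R) : 1 <= u ->
  (\int[mu]_(s in `[u, (u + k%:R)%R]) (n s)%:E <= (k%:R * m)%:E)%E.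
Proof.
move=> u1; elim: k => [|k IH].
  by rewrite addr0 set_itv1 integral_set1 mul0r.
apply: le_trans (@integral_itv_split n u (u + k%:R) _ mn n0) _.
rewrite -natr1 mulrDl mul1r EFinD leeD// addrA; apply: nm.
by rewrite (le_trans u1)// lerDl.
Qed.

(** The interval is covered by [(Num.truncn u).+1] unit intervals, and this number is at most
    [u + 1], hence at most [2 * u]. *)
Lemma integral_itv_double (u : R) : 1 <= u ->
  (\int[mu]_(s in `[u, (u + u)%R]) (n s)%:E <= (2 * u * m)%:E)%E.
Proof.
move=> u1; pose k := (Num.truncn u).+1.
have u0 : 0 <= u by rewrite (le_trans ler01).
have /andP[k1 k2] := truncn_itv u0.
apply: le_trans (_ : (\int[mu]_(s in `[u, (u + k%:R)%R]) (n s)%:E <= _)%E).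
  apply: ge0_subset_integral => //.
  - by apply/measurable_EFinP; exact: measurable_funTS.
  - by move=> s _; rewrite lee_fin.
  - move=> s; rewrite /= !in_itv /= => /andP[-> /= h]; apply: (le_trans h).
    by rewrite lerD2l ltW.
apply: le_trans (integral_itv_nat k u1) _.
by rewrite lee_fin ler_wpM2r// /k -natr1; lra.
Qed.

(* Halving [t] contracts the weight by [2 `^ (- lam)], and the mass of [n s / s] on
   a dyadic block [t / 2, t] is at most [2 * m]. *)
Lemma kernel_bound (lam : R) : 0 < lam -> forall t, 1 <= t ->
  (\int[mu]_(s in `[1%R, t]) (s `^ (- 1) * (s / t) `^ lam * n s)%:E <=
     (2 * m / (1 - 2^-1 `^ lam))%:E)%E.
Proof.
move=> l0; pose q : R := 2^-1 `^ lam.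
have p1 : 1 `^ lam = 1 :> R by rewrite powR1.
have q1 : q < 1.
  rewrite /q -[ltRHS]p1 gt0_ltr_powR// ?nnegrE ?invr_ge0//.
  by rewrite invf_lt1// ltr1n.
have q0 : 0 <= q by rewrite powR_ge0.
(* [B] is the fixed point of [B = q * B + 2 * m], so the bound by [B] at [t / 2] passes to [t]. *)
rewrite -/q; set B := 2 * m / (1 - q).
have B1 : B = q * B + 2 * m by rewrite /B; field; rewrite subr_eq0 eq_sym lt_eqF.
have B0 : 0 <= B by rewrite /B divr_ge0 ?mulr_ge0// subr_ge0 ltW.
(* The factor [s^-1] is written as a power so that [measurable_powR] applies. *)
pose G t s := s `^ (- 1) * (s / t) `^ lam * n s.
have mG t : measurable_fun setT (G t).
  apply: measurable_funM => //; apply: measurable_funM; first exact: measurable_powR.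
  apply: (measurableT_comp (measurable_powR lam)).
  by apply: measurable_funM.
have G0 t s : 0 <= G t s by rewrite !mulr_ge0 ?powR_ge0.
have mGE t D : measurable D -> measurable_fun D (fun s => (G t s)%:E).
  by move=> mD; apply/measurable_EFinP; exact: measurable_funTS.
have mE D : measurable D -> measurable_fun D (fun s => (n s)%:E).
  by move=> mD; apply/measurable_EFinP; exact: measurable_funTS.
have wle t s c : 1 <= s -> s <= t -> s^-1 <= c -> G t s <= c * n s.
  move=> s1 st sc; have s0 : 0 < s by rewrite (lt_le_trans ltr01).
  have t0 : 0 < t by rewrite (lt_le_trans s0).
  rewrite /G ler_wpM2r// powR_inv1 ?(ltW s0)//; apply: le_trans sc.
  rewrite ler_piMr ?invr_ge0 ?(ltW s0)// -[leRHS]p1.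
  rewrite ge0_ler_powR ?(ltW l0)// ?nnegrE ?divr_ge0 ?(ltW s0) ?(ltW t0)//.
  by rewrite ler_pdivrMr// mul1r.
have small t : 1 <= t -> t <= 2 -> (\int[mu]_(s in `[1%R, t]) (G t s)%:E <= B%:E)%E.
  move=> t1 t2; apply: (@le_trans _ _ (\int[mu]_(s in `[1%R, (1 + 1)%R]) (n s)%:E)%E).
    apply: (@le_trans _ _ (\int[mu]_(s in `[1%R, t]) (n s)%:E)%E).
      apply: le_integral_ge0 => s; rewrite /= in_itv /= lee_fin => /andP[s1 st]//.
      rewrite -[n s]mul1r wle// invf_le1// (lt_le_trans ltr01)//.
    apply: ge0_subset_integral => //; [exact: mE|by move=> s _; rewrite lee_fin|].
    by move=> s; rewrite /= !in_itv /= => /andP[-> /= st]; rewrite (le_trans st).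
  apply: le_trans (nm (lexx 1)) _; rewrite lee_fin B1.
  by have qB := mulr_ge0 q0 B0; have mm := m0; lra.
move=> t; have [k] : exists k : nat, t <= 2 ^+ k.
  have [t0|/ltW t0] := leP 0 t; last by exists 0%N; rewrite (le_trans t0).
  exists (Num.truncn t).+1; have /andP[_ /ltW /le_trans] := truncn_itv t0; apply.
  by rewrite -natrX ler_nat ltnW// ltn_expl.
elim: k t => [|k IH] t tk t1; first by apply: small => //; rewrite (le_trans tk)// ler1n.
have [t2|t2] := leP t 2; first exact: small.
apply: le_trans (@integral_itv_split (G t) 1 (t / 2) t (mG t) (G0 t)) _.
have h2 : 1 <= t / 2 by rewrite ler_pdivlMr// mul1r ltW.
rewrite B1 EFinD leeD//.
  have -> : (\int[mu]_(s in `[1%R, (t / 2)%R]) (G t s)%:E =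
      \int[mu]_(s in `[1%R, (t / 2)%R]) (q%:E * (G (t / 2)%R s)%:E))%E.
    apply: eq_integral => s; rewrite inE /= in_itv /= => /andP[s1 _].
    have s0 : 0 <= s by rewrite (le_trans ler01).
    rewrite -EFinM /G.
    have -> : s / t = s / (t / 2) * 2^-1 by field; rewrite gt_eqF// (lt_trans _ t2).
    rewrite powRM ?invr_ge0// -/q; last first.
      by rewrite divr_ge0// (le_trans ler01).
    by congr (_%:E); ring.
  rewrite ge0_integralZl//; [|exact: mGE|by move=> s _; rewrite lee_fin].
  rewrite EFinM lee_wpmul2l ?lee_fin//; apply: IH => //.
  by rewrite ler_pdivrMr// -exprSr.
apply: (@le_trans _ _ (\int[mu]_(s in `[(t / 2)%R, t]) ((2 / t)%:E * (n s)%:E))%E).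
  apply: le_integral_ge0 => s; rewrite /= in_itv /= => /andP[s1 st].
    by rewrite lee_fin.
  rewrite -EFinM lee_fin wle// ?(le_trans h2)//.
  rewrite -[2 / t]invf_div lef_pV2 ?posrE ?(lt_le_trans _ h2)//.
  by rewrite (lt_le_trans _ (le_trans h2 s1)).
rewrite ge0_integralZl//; [|exact: mE| |]; first last.
- by rewrite lee_fin divr_ge0// (le_trans ler01).
- by move=> s _; rewrite lee_fin.
have dbl := integral_itv_double h2; rewrite -splitr in dbl.
have t0 : 0 <= 2 / t by rewrite divr_ge0// (le_trans ler01).
apply: (@le_trans _ _ ((2 / t)%:E * (2 * (t / 2) * m)%:E)%E).
  by rewrite lee_wpmul2l ?lee_fin.
rewrite -EFinM lee_fin le_eqVlt; apply/orP; left; apply/eqP; field.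
by rewrite gt_eqF// (lt_trans _ t2).
Qed.

End scalar.

(** * Evolution families *)

Section evolution.
Context {R : realType} {X : completeNormedModType R}.
Local Notation mu := (@lebesgue_measure R).
Variables (T : R -> R -> X -> X) (N : R -> X -> R) (M a : R).
Hypotheses (evT : evolution_family T) (nfN : norm_family N) (M0 : 0 < M) (a0 : 0 < a).
Hypothesis growth : forall t s x, 1 <= s -> s <= t ->
  N t (T t s x) <= M * (t / s) `^ a * N s x.

Lemma N_seminorm t : 1 <= t -> seminorm (N t).
Proof. by case: nfN => h1 h2 _ _ t1; split => *; [exact: h1|exact: h2]. Qed.

Lemma N_ge0 t x : 1 <= t -> 0 <= N t x.
Proof. by move=> t1; exact/seminorm_ge0/N_seminorm. Qed.

Lemma norm_le_N t x : 1 <= t -> `|x| <= N t x.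
Proof. by case: nfN => _ _ [C [e [_ [_ h]]]] _ t1; have /andP[] := h x t t1. Qed.

Lemma N_bound b : 1 <= b -> exists2 K, 0 <= K &
  forall s x, 1 <= s -> s <= b -> N s x <= K * `|x|.
Proof.
move=> b1; case: nfN => _ _ [C [e [C0 [e0 h]]]] _.
exists (C * b `^ e); first by rewrite mulr_ge0 ?powR_ge0 ?ltW.
move=> s x s1 sb; have /andP[_ /le_trans] := h x s s1; apply.
rewrite ler_wpM2r// ler_wpM2l ?(ltW C0)//.
by apply: ge0_ler_powR => //; rewrite nnegrE (le_trans ler01).
Qed.

Lemma N_continuous s : 1 <= s -> continuous (N s).
Proof.
move=> s1 x; have [K K0 hK] := N_bound s1; have sp := N_seminorm s1.
apply/cvgrPdist_le => e e0; have K1 : 0 < K + 1 by rewrite ltr_wpDl.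
have eK : 0 < e / (K + 1) by rewrite divr_gt0.
have lip u v : N s u - N s v <= K * `|u - v|.
  rewrite lerBlDr; apply: le_trans (_ : N s (u - v) + N s v <= _).
    by rewrite -{1}(subrK v u); exact: sp.1.
  by rewrite lerD2r hK.
near=> w; apply: (@le_trans _ _ (K * `|x - w|)).
  rewrite ler_norml lip andbT lerNl opprB (le_trans (lip _ _))//.
  by rewrite distrC.
apply: (@le_trans _ _ (K * (e / (K + 1)))).
  by rewrite ler_wpM2l//; near: w; exact: cvgr_dist_le.
by rewrite mulrCA ler_piMr ?(ltW e0)// ler_pdivrMr//; lra.
Unshelve. all: by end_near. Qed.

Lemma T_linear t s : 1 <= s -> s <= t -> forall (c : R) u v,
  T t s (c *: u + v) = c *: T t s u + T t s v.
Proof. by case: evT => h _ _ _ s1 st; have [] := h t s s1 st. Qed.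

Lemma T_sub t s u v : 1 <= s -> s <= t -> T t s u - T t s v = T t s (u - v).
Proof.
by move=> s1 st; rewrite -scaleN1r addrC -T_linear// scaleN1r addrC.
Qed.

Lemma T_0 t s : 1 <= s -> s <= t -> T t s 0 = 0.
Proof. by move=> s1 st; have := T_sub 0 0 s1 st; rewrite !subrr. Qed.

Lemma T_scale t s (c : R) u : 1 <= s -> s <= t -> T t s (c *: u) = c *: T t s u.
Proof. by move=> s1 st; have := T_linear s1 st c u 0; rewrite T_0// !addr0. Qed.

(** The growth estimate is placed between the two comparisons of [N] with the norm; [t / s <= b]
    because [1 <= s]. *)
Lemma T_bound b : 1 <= b -> exists2 K, 0 <= K &
  forall t s u, 1 <= s -> s <= t -> t <= b -> `|T t s u| <= K * `|u|.
Proof.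
move=> b1; have [K K0 hK] := N_bound b1.
exists (M * b `^ a * K); first by rewrite !mulr_ge0 ?powR_ge0// ltW.
move=> t s u s1 st tb; have t1 : 1 <= t by rewrite (le_trans s1).
apply: le_trans (norm_le_N _ t1) _; apply: le_trans (growth _ s1 st) _.
have s0 : 0 < s by rewrite (lt_le_trans ltr01).
have tsb : t / s <= b.
  by rewrite ler_pdivrMr// (le_trans tb)// ler_peMr// (le_trans ler01).
rewrite -[leRHS]mulrA; apply: ler_pM.
- by rewrite mulr_ge0 ?powR_ge0 ?ltW.
- exact: N_ge0.
- rewrite ler_wpM2l ?(ltW M0)//; apply: ge0_ler_powR => //; first exact: ltW.
    by rewrite nnegrE divr_ge0// ltW// (lt_le_trans ltr01).
  by rewrite nnegrE (le_trans ler01).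
- by rewrite hK// (le_trans st).
Qed.

Lemma invT_bound b : 1 <= b -> exists2 K, 0 <= K &
  forall t s u, 1 <= s -> s <= t -> t <= b -> `|s^-1 *: T t s u| <= K * `|u|.
Proof.
move=> b1; have [K K0 hK] := T_bound b1; exists K => // t s u s1 st tb.
apply: le_trans (hK t s u s1 st tb); rewrite normrZ ler_piMl//.
by rewrite ger0_norm ?invr_ge0 ?(le_trans ler01)// invf_le1// (lt_le_trans ltr01).
Qed.

Lemma T_cont tau x s : 1 <= tau -> tau <= s -> forall e, 0 < e ->
  exists2 d, 0 < d & forall u, tau <= u -> `|u - s| < d ->
    `|T u tau x - T s tau x| <= e.
Proof.
case: evT => _ _ _ h t1 ts e e0.
have /subspace_continuousP /(_ s) := h tau x t1.
rewrite /= in_itv /= andbT => /(_ ts) /cvgrPdist_le /(_ e e0).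
rewrite near_withinE => /nbhs_ballP[d /= d0 hd]; exists d => // u tu us.
rewrite distrC; apply: hd => //; first by rewrite -ball_normE /= distrC.
by rewrite /= in_itv /= tu.
Qed.

(** For [s <= w <= t] both terms factor through [T t w], which is bounded uniformly in [w]; what
    remains is the difference of [w^-1 *: u] and [s^-1 *: T w s u], small by continuity of the
    forward orbit of [u]. *)
Lemma invT_rcont t u : 1 <= t -> rcont t (fun s => s^-1 *: T t s u).
Proof.
move=> t1 s s1 st e e0; case: evT => _ Tid Tco _.
have [K K0 hK] := T_bound t1.
have K1 : 0 < K + 1 by rewrite ltr_wpDl.
have e1 : 0 < e / (K + 1) / 2 by rewrite !divr_gt0.
have u1 : 0 < `|u| + 1 by rewrite ltr_wpDl.
have [d d0 hd] := T_cont u s1 (lexx s) e1.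
exists (Num.min d (e / (K + 1) / 2 / (`|u| + 1))).
  by rewrite lt_min d0 /= !divr_gt0.
move=> w sw wt wd; have w1 : 1 <= w by rewrite (le_trans s1).
have s0 : 0 < s by rewrite (lt_le_trans ltr01).
have w0 : 0 < w by rewrite (lt_le_trans ltr01).
have ws : 0 <= w - s by rewrite subr_ge0.
rewrite -(Tco t w s u)// -!T_scale// T_sub//.
apply: le_trans (hK _ _ _ _ _ _) _ => //.
have h1 : `|s^-1 *: T w s u - s^-1 *: u| <= e / (K + 1) / 2.
  rewrite -scalerBr normrZ -{2}(Tid s s1 u).
  apply: le_trans (_ : 1 * `|T w s u - T s s u| <= _).
    rewrite ler_wpM2r// ger0_norm ?invr_ge0 ?(ltW s0)//.
    by rewrite invf_le1.
  rewrite mul1r hd// ger0_norm//.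
  by move: wd; rewrite -ltrBlDl lt_min => /andP[].
have h2 : `|w^-1 *: u - s^-1 *: u| <= e / (K + 1) / 2.
  rewrite -scalerBl normrZ.
  have ds : w - s <= e / (K + 1) / 2 / (`|u| + 1).
    by move: wd; rewrite -ltrBlDl lt_min => /andP[_ /ltW].
  have di : `|w^-1 - s^-1| <= w - s.
    have -> : w^-1 - s^-1 = - ((w - s) / (w * s)).
      by field; rewrite !gt_eqF.
    have q0 : 0 <= (w - s) / (w * s) by rewrite divr_ge0// mulr_ge0// ltW.
    rewrite normrN ger0_norm//.
    by rewrite ler_pdivrMr ?mulr_gt0// ler_peMr// mulr_ege1.
  apply: le_trans (_ : e / (K + 1) / 2 / (`|u| + 1) * (`|u| + 1) <= _); last first.
    by rewrite divfK ?gt_eqF.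
  by apply: ler_pM => //; [exact: le_trans ds|rewrite lerDl].
apply: le_trans (_ : K * (e / (K + 1)) <= _); last first.
  by rewrite mulrCA ler_piMr ?(ltW e0)// ler_pdivrMr//; lra.
rewrite ler_wpM2l// [leRHS]splitr.
rewrite -(subrK (s^-1 *: u) (w^-1 *: u)) -addrA.
apply: le_trans (ler_normD _ _) _; rewrite lerD//.
by rewrite T_scale// distrC.
Qed.

(** * The integral defining [x t], and its existence *)

Local Notation Lam t y := (bochner_integral `[1, t] (fun s => s^-1 *: T t s (y s))).

Lemma Y1_clean y b : in_Y1 N y -> 1 <= b -> exists Z y' r,
  [/\ measurable Z, mu Z = 0%E,
      (forall s, y' s = (\1_(`[1, b] `\` Z) s : R) *: y s) & goodseq `[1, b] y' r].
Proof.
move=> [yb _] b1; have [v] := yb b b1.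
move=> /(bochner_clean (measurable_itv _) (itv_measure_fin _ _)).
by move=> [Z [y' [r [mZ Z0 yy gy _]]]]; exists Z, y', r.
Qed.

(** By [goodseq_op], sampled operators applied to simple approximations of [y] approximate the
    integrand off a null set. *)
Lemma Lam_exists y t : in_Y1 N y -> 1 <= t -> exists v, Lam t y v.
Proof.
move=> y1 t1; have [Z [y' [r [mZ Z0 yy gy]]]] := Y1_clean y1 t1.
have [K K0 hK] := invT_bound t1.
have mD : measurable `[1, t]%classic by exact: measurable_itv.
have := @goodseq_op _ _ t K (fun s u => s^-1 *: T t s u) y' r t1 K0.
have H1 s : 1 <= s -> s <= t -> forall (c : R) u v,
    s^-1 *: T t s (c *: u + v) = c *: (s^-1 *: T t s u) + s^-1 *: T t s v.
  by move=> s1 st c u v; rewrite T_linear// scalelin.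
have H2 s : 1 <= s -> s <= t -> forall u, `|s^-1 *: T t s u| <= K * `|u|.
  by move=> s1 st u; exact: hK.
move=> /(_ H1 H2 (fun u => invT_rcont u t1) gy) g1.
have [v cv] := goodseq_cvg mD (itv_measure_fin _ _) g1.
exists v; apply: (bochner_unclean mD mZ Z0 _ g1 cv) => s Ds nZ.
by rewrite yy indicE mem_set ?scale1r.
Qed.


(** * Contraction implies admissibility *)

(** In the norm [N t] the integrand is at most [D0] times the kernel of [kernel_bound], whose
    integral is bounded independently of [t]. *)
Lemma Lam_bounded y lam D0 : in_Y1 N y -> 0 < lam -> 0 < D0 ->
  (forall x t tau, 1 <= tau -> tau <= t ->
     N t (T t tau x) <= D0 * (t / tau) `^ (- lam) * N tau x) ->
  exists B, forall t v, 1 <= t -> Lam t y v -> N t v <= B.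
Proof.
move=> y1 l0 D00 contr; have [_ [m hm]] := y1.
exists (D0 * (2 * m / (1 - 2^-1 `^ lam))) => t v t1 Lv.
have [Z [y' [r [mZ Z0 yy gy]]]] := Y1_clean y1 t1; have [mr cr _] := gy.
pose D : set R := `[1, t]%classic.
have mD : measurable D by exact: measurable_itv.
have D1 s : D s -> 1 <= s by rewrite /D /= in_itv /= => /andP[].
(* Using [y'] makes [n] measurable, and extending it by zero outside [D] gives a function on the
   whole line; its mass on unit intervals is still at most [m], whatever [t] is. *)
pose n := (fun s => N s (y' s)) \_ D.
have mN w : measurable_fun D (N ^~ w).
  case: nfN => _ _ _ /(_ w); apply: measurable_funS; first exact: measurable_itv.
  by move=> s; rewrite /D /= !in_itv /= => /andP[->].
have mn : measurable_fun setT n.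
  apply/(measurable_restrictT _ mD).
  by apply: (good_measurable mD mN _ mr cr) => s /D1; exact: N_continuous.
have n0 s : 0 <= n s.
  by rewrite /n patchE; case: ifP => // /set_mem /D1; exact: N_ge0.
have nm u : 1 <= u -> (\int[mu]_(s in `[u, (u + 1)%R]) (n s)%:E <= m%:E)%E.
  move=> u1; apply: le_trans (hm u u1); apply: le_integral_ge0 => s.
    by rewrite lee_fin.
  rewrite /= in_itv /= lee_fin => /andP[us _]; have s1 := le_trans u1 us.
  rewrite /n patchE; case: ifP => _; last exact: N_ge0.
  rewrite yy (N_seminorm s1).2 ler_piMl ?N_ge0// indicE.
  by case: (_ \in _); rewrite ?normr1 ?normr0.
have [C C0 hC] := N_bound t1.
pose w s := s `^ (- 1) * (s / t) `^ lam * n s.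
have w0 s : 0 <= w s by rewrite !mulr_ge0 ?powR_ge0.
have mw : measurable_fun setT w.
  apply: measurable_funM => //; apply: measurable_funM; first exact: measurable_powR.
  apply: (measurableT_comp (measurable_powR lam)).
  by apply: measurable_funM.
have := @bochner_le _ _ (N t) C D Z _ (fun s => D0 * w s) v (N_seminorm t1) C0
  (fun u => hC t u t1 (lexx t)) mD (itv_measure_fin _ _) mZ Z0 Lv.
have h1 : measurable_fun D (fun s => D0 * w s).
  by apply: measurable_funTS; exact: measurable_funM.
have h2 s : D s -> 0 <= D0 * w s by move=> _; rewrite mulr_ge0 ?(ltW D00).
have h3 s : D s -> ~ Z s -> N t (s^-1 *: T t s (y s)) <= D0 * w s.
  move=> Ds nZ; have s1 := D1 _ Ds; have s0 : 0 < s by rewrite (lt_le_trans ltr01).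
  have st : s <= t by move: Ds; rewrite /D /= in_itv /= => /andP[].
  rewrite (N_seminorm t1).2 ger0_norm ?invr_ge0 ?(ltW s0)//.
  rewrite /w powR_inv1 ?(ltW s0)//.
  rewrite [leRHS](_ : _ = s^-1 * (D0 * ((s / t) `^ lam * n s))); last by ring.
  rewrite ler_wpM2l ?invr_ge0 ?(ltW s0)//.
  apply: le_trans (contr _ _ _ s1 st) _; rewrite -mulrA ler_wpM2l ?(ltW D00)//.
  rewrite powRN -powR_inv1 ?powR_ge0// -powRAC powR_inv1 ?divr_ge0 ?(le_trans ler01)//.
  rewrite invf_div /n patchE mem_set// yy indicE mem_set// scale1r.
  exact: lexx.
move=> /(_ h1 h2 h3) /le_trans; rewrite -lee_fin; apply.
under eq_integral do rewrite EFinM.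
rewrite ge0_integralZl//; last 3 first.
- by apply/measurable_EFinP; exact: measurable_funTS.
- by move=> s _; rewrite lee_fin.
- by rewrite lee_fin ltW.
rewrite EFinM lee_wpmul2l ?lee_fin ?(ltW D00)//.
exact: kernel_bound.
Qed.

(** By the cocycle law [T t r v] is the integral over [[1, r]] of the integrand belonging to [t].
    The remaining part, after [r], is small uniformly for [t <= b] by absolute continuity. *)
Lemma Lam_tail y b : in_Y1 N y -> 1 <= b -> forall e, 0 < e ->
  exists2 d, 0 < d & forall t r u v, 1 <= r -> r <= t -> t <= b -> t <= r + d ->
    Lam t y u -> Lam r y v -> `|u - T t r v| <= e.
Proof.
move=> y1 b1 e e0; have [Z [y' [q [mZ Z0 yy gy]]]] := Y1_clean y1 b1.
have [K K0 hK] := invT_bound b1.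
have K1 : 0 < K + 1 by rewrite ltr_wpDl.
have e1 : 0 < e / (K + 1) by rewrite divr_gt0.
have mD : measurable `[1, b]%classic by exact: measurable_itv.
have [d d0 hd] := integral_norm_abs_cont mD gy e1.
exists d => // t r u v r1 rt tb td Lu Lv; have t1 := le_trans r1 rt.
pose E : set R := `[1, t]%classic `\` `[1, r]%classic.
have mE : measurable E by apply: measurableD; exact: measurable_itv.
have ED : E `<=` `[1, b]%classic.
  by move=> s []; rewrite /= !in_itv /= => /andP[-> /= st] _; rewrite (le_trans st).
have mEd : (mu E <= d%:E)%E.
  apply: (@le_trans _ _ (mu `[r, t])).
    apply: le_measure; rewrite ?inE//.
    move=> s []; rewrite /= !in_itv /= => /andP[-> ->] /negP /=.
    by rewrite -ltNge andbT => /ltW.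
  rewrite lebesgue_measure_itv /=; case: ifP => _; last by rewrite lee_fin ltW.
  by rewrite lee_fin lerBlDl.
have Lv' := bochner_map (measurable_itv _) (itv_measure_fin _ _) _ Lv.
have {}Lv' : bochner_integral `[1, r] (T t r \o (fun s => s^-1 *: T r s (y s))) (T t r v).
  by apply: Lv'; case: evT => h _ _ _; exact: h.
have := @bochner_le_diff _ _ _ 1 `[1, t]%classic `[1, r]%classic Z _ _
  (fun s => K * `|y' s|) u (T t r v) (@seminorm_norm R X) ler01.
have my : measurable_fun `[1, b]%classic (fun s => `|y' s|).
  have [mr cr _] := gy.
  apply: (@good_measurable _ _ (fun s w => `|w|) _ _ q) => //.
  by move=> s _ x; exact: cvg_norm.
have myE : measurable_fun E (fun s => `|y' s|) by exact: measurable_funS my.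
move=> /(_ _ _ _ (measurable_itv _) (itv_measure_fin _ _) (measurable_itv _) _ mZ Z0 Lu Lv') H.
rewrite -lee_fin; apply: le_trans (H _ _ _ _ _ _) _.
- by move=> x; rewrite mul1r.
- by move=> s; rewrite /= !in_itv /= => /andP[-> /= st]; rewrite (le_trans st).
- move=> s; rewrite /= in_itv /= => /andP[s1 sr] _.
  by rewrite T_scale//; case: evT => _ _ co _; rewrite co.
- exact: measurable_funM.
- by move=> s _; rewrite mulr_ge0.
- move=> s Es nZ; have := ED _ Es; move: Es => [].
  rewrite /= !in_itv /= => /andP[s1 st] _ /andP[_ sb].
  rewrite yy indicE mem_set ?scale1r ?hK//; split => //.
  by rewrite /= in_itv /= s1.
under eq_integral do rewrite EFinM.
rewrite ge0_integralZl//; [|exact/measurable_EFinP].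
apply: (@le_trans _ _ (K%:E * (e / (K + 1))%:E)%E).
  by rewrite lee_wpmul2l ?lee_fin// hd.
by rewrite -EFinM lee_fin mulrCA ler_piMr ?(ltW e0)// ler_pdivrMr//; lra.
Qed.

Lemma contraction_imp_Y0 y : in_Y1 N y -> polynomial_contraction T N ->
  exists x : R -> X, in_Y0 N x /\ forall t, 1 <= t -> Lam t y (x t).
Proof.
move=> y1 [_ _ _ [lam [D0 [l0 [D00 [contr _]]]]]].
pose x t := xget 0 [set v | Lam t y v].
have Lx t : 1 <= t -> Lam t y (x t).
  by move=> t1; apply: (@xgetPex _ 0 [set v | Lam t y v]); exact: Lam_exists.
exists x; split => //; split.
- apply/subspace_continuousP => t0; rewrite /= in_itv /= andbT => t01.
  apply/cvgrPdist_le => e e0; have e3 : 0 < e / 3 by rewrite divr_gt0.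
  have b1 : 1 <= t0 + 1 by rewrite (le_trans t01)// lerDl.
  have [d d0 hd] := Lam_tail y1 b1 e3.
  (* Starting slightly before [t0], but not before 1, puts [t0] and all nearby [t] within distance
     [d] after [r], so that left and right continuity are treated together. *)
  pose r := Num.max 1 (t0 - d / 2).
  have r1 : 1 <= r by rewrite le_max lexx.
  have d2 : 0 < d / 2 by rewrite divr_gt0.
  have rt0 : r <= t0 by rewrite ge_max t01 /=; lra.
  have tr : t0 <= r + d / 2 by rewrite -lerBlDr le_max lexx orbT.
  have [c c0 hc] := T_cont (x r) r1 rt0 e3.
  rewrite near_withinE; apply/nbhs_ballP.
  exists (Num.min c (Num.min 1 (d / 2))); first by rewrite /= !lt_min c0 ltr01.
  move=> t; rewrite -ball_normE /= !lt_min => /and3P[tc tt1 td].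
  rewrite in_itv /= andbT => t1; rewrite distrC in tc tt1 td.
  move: (td); rewrite ltr_norml => /andP[ta tb].
  move: (tt1); rewrite ltr_norml => /andP[_ tb1].
  have rt : r <= t by rewrite ge_max t1 /=; lra.
  have k1 : `|x t - T t r (x r)| <= e / 3 by apply: hd => //; try exact: Lx; lra.
  have k2 : `|x t0 - T t0 r (x r)| <= e / 3 by apply: hd => //; try exact: Lx; lra.
  have k3 := hc t rt tc.
  have -> : x t0 - x t = (x t0 - T t0 r (x r)) - (x t - T t r (x r))
      - (T t r (x r) - T t0 r (x r)).
    by rewrite [RHS]addrAC !opprB !addrA !subrK.
  apply: le_trans (ler_normB _ _) _.
  have := ler_normB (x t0 - T t0 r (x r)) (x t - T t r (x r)); lra.
- have [B hB] := Lam_bounded y1 l0 D00 contr.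
  by exists B => t t1; apply: hB => //; exact: Lx.
- have := @bochner_le _ _ _ 1 `[1, 1]%classic set0 _ (fun s => `|s^-1 *: T 1 s (y s)|)
    (x 1) (@seminorm_norm R X) ler01 _ (measurable_itv _) (itv_measure_fin _ _)
    measurable0 (measure0 _) (Lx 1 (lexx 1)).
  rewrite set_itv1 integral_set1 lee_fin normr_le0 => H; apply/eqP; apply: H => //.
  + by move=> u; rewrite mul1r.
  + exact: measurable_fun_set1.
Qed.

(** * Uniform boundedness *)

(** The ball of radius [c] among right-continuous functions for the supremum of [N s (y s)]. It lies
    in [in_Y1], uniform limits stay right-continuous, and the functions [pieces] belong to such
    balls. *)
Definition inV c (y : R -> X) : Prop :=
  (forall b, rcont b y) /\ forall s, 1 <= s -> N s (y s) <= c.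

Lemma inV_lin c d (k : R) y z : inV c y -> inV d z ->
  inV (c + `|k| * d) (fun s => y s + k *: z s).
Proof.
move=> [ry cy] [rz dz]; split; last first.
  move=> s s1; apply: le_trans ((N_seminorm s1).1 _ _) _.
  by rewrite lerD ?cy// (N_seminorm s1).2 ler_wpM2l// dz.
move=> b s s1 sb e e0; have k1 : 0 < `|k| + 1 by rewrite ltr_wpDl.
have e2 : 0 < e / 2 by rewrite divr_gt0.
have e3 : 0 < e / 2 / (`|k| + 1) by rewrite divr_gt0.
have [d1 d10 h1] := ry b s s1 sb _ e2.
have [d2 d20 h2] := rz b s s1 sb _ e3.
exists (Num.min d1 d2); first by rewrite lt_min d10.
move=> u su ub ud.
have [ud1 ud2] : u < s + d1 /\ u < s + d2.
  by apply/andP; move: ud; rewrite -!ltrBlDl lt_min.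
rewrite opprD addrACA -scalerBr [e]splitr.
apply: le_trans (ler_normD _ _) _; rewrite lerD ?h1// normrZ.
apply: le_trans (_ : `|k| * (e / 2 / (`|k| + 1)) <= _).
  by rewrite ler_wpM2l// h2.
by rewrite mulrCA ler_piMr ?(ltW e2)// ler_pdivrMr//; lra.
Qed.

Lemma inV_le c d y : c <= d -> inV c y -> inV d y.
Proof. by move=> cd [ry cy]; split => // s s1; apply: le_trans (cy s s1) cd. Qed.

Lemma inV0 : inV 0 (fun=> 0).
Proof.
split => [b s _ _ e e0|s s1]; last by rewrite seminorm0//; exact: N_seminorm.
by exists 1 => // u _ _ _; rewrite subrr normr0 ltW.
Qed.

Lemma inV_Y1 c y : inV c y -> in_Y1 N y.
Proof.
move=> [ry cy]; split.
  move=> b b1; have [|v bv _] := @bochner_good _ _ `[1, b]%classic y _ (measurable_itv _)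
    (itv_measure_fin _ _) (@goodseq_rcont _ _ b c y b1 (ry b) _); last by exists v.
  by move=> s s1 _; apply: le_trans (norm_le_N _ s1) (cy s s1).
exists c => t t1; have mD : measurable `[t, t + 1]%classic by exact: measurable_itv.
apply: (@le_trans _ _ (\int[mu]_(s in `[t, (t + 1)%R]) cst c%:E s)%E).
  apply: le_integral_ge0 => s; rewrite /= in_itv /= lee_fin => /andP[ts _].
    by apply: N_ge0; rewrite (le_trans t1).
  by apply: cy; rewrite (le_trans t1).
rewrite integral_cst// [X in (_ * X)%E](_ : _ = 1%E) ?mule1//.
by rewrite [LHS]lebesgue_measure_itv /= lte_fin ltrDl ltr01 -EFinB addrAC subrr add0r.
Qed.

Lemma Lam_unique t y u v : Lam t y u -> Lam t y v -> u = v.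
Proof. exact: bochner_unique (measurable_itv _) (itv_measure_fin _ _). Qed.

Lemma Lam_lin t (c : R) y z u v : Lam t y u -> Lam t z v ->
  Lam t (fun s => y s + c *: z s) (u + c *: v).
Proof.
move=> Lu Lv.
apply: (bochner_eq (measurable_itv _) (itv_measure_fin _ _) _
  (bochner_lin c (measurable_itv _) (itv_measure_fin _ _) Lu Lv)).
move=> s; rewrite /= in_itv /= => /andP[s1 st].
by rewrite addrC [in RHS]addrC T_linear// scalelin.
Qed.

(** This crude bound grows with [t]. It makes the suprema in [uniform_bound] finite and, for
    [c = 0], shows that the zero input has zero output. *)
Lemma Lam_inV_bound t c y v : 1 <= t -> inV c y -> Lam t y v ->
  N t v <= M * t `^ a * c * (t - 1).
Proof.
move=> t1 [ry cy] Lv; have [C C0 hC] := N_bound t1.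
have c0 : 0 <= c by apply: le_trans (cy 1 (lexx 1)); exact: N_ge0.
have B0 : 0 <= M * t `^ a * c by rewrite !mulr_ge0 ?powR_ge0// ltW.
have mD : measurable `[1, t]%classic by exact: measurable_itv.
have := @bochner_le _ _ (N t) C `[1, t]%classic set0 _ (fun s => M * t `^ a * c) v
  (N_seminorm t1) C0 (fun u => hC t u t1 (lexx t)) mD
  (itv_measure_fin _ _) measurable0 (measure0 _) Lv.
rewrite (integral_cst mu mD (M * t `^ a * c)%:E) [X in (_ * X)%E](itv_measure t1).
rewrite -EFinM lee_fin; apply => // s; rewrite /= in_itv /= => /andP[s1 st] _.
have s0 : 0 < s by rewrite (lt_le_trans ltr01).
rewrite (N_seminorm t1).2 ger0_norm ?invr_ge0 ?(ltW s0)//.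
apply: le_trans (_ : 1 * N t (T t s (y s)) <= _).
  by rewrite ler_wpM2r ?N_ge0// invf_le1.
rewrite mul1r; apply: le_trans (growth _ s1 st) _; apply: ler_pM => //.
- by rewrite mulr_ge0 ?powR_ge0// ltW.
- exact: N_ge0.
- rewrite ler_wpM2l ?(ltW M0)//; apply: ge0_ler_powR => //; first exact: ltW.
  + by rewrite nnegrE divr_ge0 ?(ltW s0)// (le_trans ler01).
  + by rewrite nnegrE (le_trans ler01).
  + by rewrite ler_pdivrMr// ler_peMr// (le_trans ler01).
- exact: cy.
Qed.

(** The coefficient of [y k] may depend on the partial sum built so far, which leaves room for the
    choice of signs. *)
Fixpoint hump (g : nat -> (R -> X) -> R) (y : nat -> R -> X) n : R -> X :=
  if n is k.+1 then fun s => hump g y k s + g k (hump g y k) *: y k s else fun=> 0.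

Lemma inV_hump g y n : (forall k, inV 1 (y k)) -> exists c, inV c (hump g y n).
Proof.
move=> yV; elim: n => [|n [c IH]]; first by exists 0; exact: inV0.
by eexists; exact: inV_lin IH (yV n).
Qed.

(** The right-hand side is the geometric sum of [3^-1 ^+ j] over [n <= j < n + k]. *)
Lemma hump_dist g y s n k : (forall k, inV 1 (y k)) -> 1 <= s ->
  (forall k z, `|g k z| = 3^-1 ^+ k) ->
  N s (hump g y (n + k) s - hump g y n s) <= 3 / 2 * (3^-1 ^+ n - 3^-1 ^+ (n + k)).
Proof.
move=> yV s1 gE; have sp := N_seminorm s1; elim: k => [|k IH].
  by rewrite addn0 !subrr seminorm0// mulr0.
rewrite addnS /= addrAC; apply: le_trans (sp.1 _ _) _.
rewrite sp.2 gE exprS.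
have : 3^-1 ^+ (n + k) * N s (y (n + k)%N s) <= 3^-1 ^+ (n + k) * 1.
  by rewrite ler_wpM2l ?exprn_ge0 ?invr_ge0//; exact: (yV _).2.
by move: IH; set A := N s _; set B := _ * N s _; set p := _ ^+ (n + k); lra.
Qed.

Lemma pow3_small (e : R) : 0 < e -> exists n : nat, 3^-1 ^+ n < e.
Proof.
move=> e0; have [n _ /(_ n (leqnn n)) /= hn] := near_infty_natSinv_lt (PosNum e0).
exists n; apply: le_lt_trans hn; rewrite exprVn lef_pV2 ?posrE ?exprn_gt0//.
by rewrite -natrX ler_nat ltn_expl.
Qed.

(** Since [N s] dominates the norm, the partial sums converge pointwise. The geometric bound passes
    to the limit by continuity of [N s] and makes the convergence uniform, which preserves
    right-continuity. The form [(-1) *:] fits [Lam_lin]. *)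
Lemma hump_lim g y : (forall k, inV 1 (y k)) -> (forall k z, `|g k z| = 3^-1 ^+ k) ->
  exists z, forall n, inV (3 / 2 * 3^-1 ^+ n) (fun s => z s + (-1) *: hump g y n s).
Proof.
move=> yV gE; set S := hump g y.
have SS n k s : 1 <= s -> (n <= k)%N -> N s (S k s - S n s) <= 3 / 2 * 3^-1 ^+ n.
  move=> s1 nk; have := hump_dist n (k - n) yV s1 gE; rewrite subnKC// => /le_trans; apply.
  by rewrite ler_wpM2l ?divr_ge0// gerBl exprn_ge0 ?invr_ge0.
have small (e : R) : 0 < e -> exists n : nat, 3 / 2 * 3^-1 ^+ n < e.
  move=> e0; have [|n hn] := @pow3_small (2 / 3 * e); first by rewrite mulr_gt0 ?divr_gt0.
  exists n; lra.
have cS s : 1 <= s -> cvg ((S ^~ s) @ \oo).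
  move=> s1; apply: cauchy_cvg; apply: cauchy_exP => e e0.
  have [n hn] := small e e0; exists (S n s); exists n => // k nk.
  rewrite -ball_normE /= distrC; apply: le_lt_trans hn.
  by apply: le_trans (norm_le_N _ s1) _; exact: SS.
pose z s := lim ((S ^~ s) @ \oo); exists z => n.
have zS m s : 1 <= s -> N s (z s - S m s) <= 3 / 2 * 3^-1 ^+ m.
  move=> s1; have cNS : (fun k => N s (S k s - S m s)) @ \oo --> N s (z s - S m s).
    apply: continuous_cvg; first exact: N_continuous.
    by apply: cvgB; [exact: cS|exact: cvg_cst].
  rewrite -(cvg_lim _ cNS)//; apply: limr_le; first by apply/cvg_ex; exists (N s (z s - S m s)).
  by exists m => // k mk; exact: SS.
have rz b : rcont b z.
  move=> s s1 sb e e0; have e3 : 0 < e / 3 by rewrite divr_gt0.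
  have [m hm] := small _ e3; have [c [rS _]] := inV_hump g m yV.
  have [d d0 hd] := rS b s s1 sb _ e3; exists d => // u su ub ud.
  have u1 := le_trans s1 su.
  have k1 := le_trans (norm_le_N (z s - S m s) s1) (zS m s s1).
  have k2 := le_trans (norm_le_N (z u - S m u) u1) (zS m u u1).
  have k3 := hd u su ub ud.
  have -> : z u - z s = (z u - S m u) - (z s - S m s) - (S m s - S m u).
    by rewrite [RHS]addrAC !opprB !addrA !subrK.
  apply: le_trans (ler_normB _ _) _; rewrite [`|S m s - _|]distrC.
  by have := ler_normB (z u - S m u) (z s - S m s); rewrite -/S in k3; lra.
have [c Sc] := inV_hump g n yV.
split; last by move=> s s1; rewrite scaleN1r; exact: zS.
have zV : inV (3 / 2) z.
  split => // s s1; have := zS 0%N s s1; rewrite expr0 mulr1.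
  by rewrite [S 0%N s](_ : _ = 0) ?subr0.
exact: (inV_lin (-1) zV Sc).1.
Qed.

(* Sokal's gliding hump: near-extremal test functions [y k] at times [t k] are summed
   with weights [3 ^- k], each sign being chosen so that the new term does not cancel
   the value of the previous partial sum at time [t k]. *)
Lemma uniform_bound :
  (forall y, in_Y1 N y -> exists x : R -> X, in_Y0 N x /\
     forall t, 1 <= t -> Lam t y (x t)) ->
  exists2 K, 0 <= K & forall t c y v, 1 <= t -> inV c y -> Lam t y v -> N t v <= K * c.
Proof.
move=> adm.
(* The supremum of [E t] is the operator norm of the map from the input [y] to the output at time
   [t]. *)
pose E t : set R := [set z | exists y v, [/\ inV 1 y, Lam t y v & z = N t v]].
have Lex t c y : 1 <= t -> inV c y -> exists v, Lam t y v.
  by move=> t1 /inV_Y1 y1; exact: Lam_exists.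
have Esup t : 1 <= t -> has_sup (E t).
  move=> t1; split; last first.
    exists (M * t `^ a * 1 * (t - 1)) => _ [y [v [yV Lv ->]]].
    exact: Lam_inV_bound yV Lv.
  have V0 : inV 1 (fun=> 0) by apply: inV_le inV0.
  by have [v Lv] := Lex t 1 _ t1 V0; exists (N t v), (fun=> 0), v.
have E0 t : 1 <= t -> 0 <= sup (E t).
  move=> t1; have [[z Ez] ub] := Esup t t1.
  apply: le_trans (sup_upper_bound (Esup t t1) Ez).
  by case: Ez => y [v [_ _ ->]]; exact: N_ge0.
have Ele t c y v : 1 <= t -> inV c y -> Lam t y v -> N t v <= sup (E t) * c.
  move=> t1 yV Lv.
  have : 0 <= c by apply: le_trans (yV.2 1 (lexx 1)); exact: N_ge0.
  (* Scaling by [c^-1] reduces to the unit ball; for [c = 0] the crude bound already gives zero. *)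
  rewrite le_eqVlt => /predU1P[c0|c0].
    have := Lam_inV_bound t1 yV Lv; rewrite -c0 !mulr0 mul0r //.
  have zV := inV_lin c^-1 inV0 yV.
  have [u Lu] := Lex t _ _ t1 inV0.
  have Lz := Lam_lin c^-1 Lu Lv.
  have u0 : u = 0.
    apply/eqP; rewrite -normr_le0; apply: le_trans (norm_le_N _ t1) _.
    by have := Lam_inV_bound t1 inV0 Lu; rewrite mulr0 mul0r.
  have := sup_upper_bound (Esup t t1); move=> /(_ (N t (u + c^-1 *: v))).
  rewrite u0 add0r (N_seminorm t1).2 ger0_norm ?invr_ge0 ?(ltW c0)//.
  rewrite mulrC ler_pdivrMr//; apply.
  exists (fun s => 0 + c^-1 *: y s), (u + c^-1 *: v); split => //.
    apply: inV_le zV; rewrite add0r ger0_norm ?invr_ge0 ?(ltW c0)//.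
    by rewrite mulVf ?gt_eqF.
  by rewrite u0 add0r (N_seminorm t1).2 ger0_norm ?invr_ge0 ?(ltW c0)// mulrC.
have [[K hK]|nK] := pselect (exists K, forall t, 1 <= t -> sup (E t) <= K).
  exists K; first exact: le_trans (E0 1 (lexx 1)) (hK 1 (lexx 1)).
  move=> t c y v t1 yV Lv; apply: le_trans (Ele t c y v t1 yV Lv) _.
  rewrite ler_wpM2r ?hK//.
  by apply: le_trans (yV.2 1 (lexx 1)); exact: N_ge0.
exfalso.
(* If the suprema are unbounded, one of them exceeds [n%:R * 3 ^+ n]; a test function reaching two
   thirds of it accounts for the factor [3 / 2]. *)
have /choice[F hF] : forall n : nat, exists q : R * (R -> X) * X,
    [/\ 1 <= q.1.1, inV 1 q.1.2, Lam q.1.1 q.1.2 q.2, n%:R * 3 ^+ n <= N q.1.1 q.2 * (3 / 2)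
      & sup (E q.1.1) <= N q.1.1 q.2 * (3 / 2)].
  move=> n; have [t [t1 tn]] : exists t, 1 <= t /\ n%:R * 3 ^+ n < sup (E t).
    apply: contrapT => h; apply: nK; exists (n%:R * 3 ^+ n) => t t1.
    by rewrite leNgt; apply/negP => tn; apply: h; exists t.
  have s0 : 0 < sup (E t) / 3.
    by rewrite divr_gt0// (le_lt_trans _ tn)// mulr_ge0// exprn_ge0.
  have [_ [y [v [yV Lv ->]]] hv] := sup_adherent s0 (Esup t t1).
  by exists (t, y, v); split => //=; lra.
pose t n := (F n).1.1; pose y n := (F n).1.2; pose w n := (F n).2.
have t1 n : 1 <= t n by case: (hF n).
have yV n : inV 1 (y n) by case: (hF n).
have Lw n : Lam (t n) (y n) (w n) by case: (hF n).
pose ok n (z : R -> X) := exists v, Lam (t n) (fun s => z s + 3^-1 ^+ n *: y n s) v /\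
  3^-1 ^+ n * N (t n) (w n) <= N (t n) v.
pose g n (z : R -> X) : R := if `[< ok n z >] then 3^-1 ^+ n else - (3^-1 ^+ n).
have th0 n : 0 <= 3^-1 ^+ n :> R by rewrite exprn_ge0// invr_ge0.
have gE n z : `|g n z| = 3^-1 ^+ n.
  by rewrite /g; case: ifP => _; rewrite ?normrN ger0_norm.
have [z hz] := hump_lim yV gE; set S := hump g y in hz.
have SV n : exists c, inV c (S n) by exact: inV_hump.
have low n v : Lam (t n) (S n.+1) v -> 3^-1 ^+ n * N (t n) (w n) <= N (t n) v.
  rewrite /S /= -/S => Lv; move: Lv; rewrite {1}/g; case: asboolP => [[v' [Lv' hv']] Lv|nok Lv].
    by rewrite (Lam_unique Lv Lv').
  have [c cS] := SV n; have [u Lu] := Lex (t n) c _ (t1 n) cS.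
  have sp := N_seminorm (t1 n).
  have L1 := Lam_lin (3^-1 ^+ n) Lu (Lw n).
  have L2 := Lam_lin (- 3^-1 ^+ n) Lu (Lw n).
  rewrite (Lam_unique Lv L2) scaleNr.
  (* Twice [3^-1 ^+ n *: w n] is the difference of the outputs for the two signs, so when the plus
     sign leaves too little the minus sign leaves enough. *)
  have lt1 : N (t n) (u + 3^-1 ^+ n *: w n) < 3^-1 ^+ n * N (t n) (w n).
    by rewrite ltNge; apply/negP => h; apply: nok; eexists; split; first exact: L1.
  have := sp.1 (u + 3^-1 ^+ n *: w n) (- (u - 3^-1 ^+ n *: w n)).
  rewrite (seminormN _ sp) opprB [u + _ + _]addrC addrA subrK.
  rewrite -mulr2n -scaler_nat scalerA sp.2 ger0_norm ?mulr_ge0//.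
  by move: lt1; set A := N _ _; set B := N _ (_ - _); rewrite -mulrA; set C := _ * N _ _; lra.
have zV : inV (3 / 2) z.
  have := hz 0%N; rewrite expr0 mulr1 => -[r0 b0].
  by split=> [b s s1 sb e e0|s s1];
    [have [d d0 hd] := r0 b s s1 sb e e0; exists d => // u su ub ud;
     have := hd u su ub ud
    |have := b0 s s1]; rewrite /S /= !scaler0 !addr0.
have [x [[_ [B hB] _] Lx]] := adm z (inV_Y1 zV).
(* With [W = N (t n) (w n)], the partial sum contributes at least [3^-1 ^+ n * W] at [t n] and the
   tail at most [3 / 4] of that. A quarter remains, and [3^-1 ^+ n * W] is at least [2 / 3 * n%:R],
   hence the 6. *)
have nB n : n%:R <= B * 6.
  have [_ _ _ hn hs] := hF n; rewrite -/(t n) -/(w n) in hn hs.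
  have [c cS] := SV n.+1; have [u Lu] := Lex (t n) c _ (t1 n) cS.
  have Ld := Lam_lin (-1) (Lx _ (t1 n)) Lu.
  have h1 := Ele _ _ _ _ (t1 n) (hz n.+1) Ld.
  have h2 := low n u Lu; have h3 := hB (t n) (t1 n).
  have sp := N_seminorm (t1 n).
  have h4 : N (t n) u <= N (t n) (x (t n)) + N (t n) (x (t n) + -1 *: u).
    rewrite -[N _ (_ + _)](seminormN _ sp) scaleN1r.
    by apply: le_trans (sp.1 _ _); rewrite opprB addrC subrK.
  have h5 : sup (E (t n)) * (3 / 2 * 3^-1 ^+ n.+1) <=
      N (t n) (w n) * (3 / 2) * (3 / 2 * 3^-1 ^+ n.+1).
    by rewrite ler_wpM2r// mulr_ge0 ?divr_ge0.
  have h6 : n%:R <= 3^-1 ^+ n * N (t n) (w n) * (3 / 2).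
    have : 3^-1 ^+ n * (n%:R * 3 ^+ n) <= 3^-1 ^+ n * (N (t n) (w n) * (3 / 2)).
      by rewrite ler_wpM2l.
    have e3 : 3^-1 ^+ n * 3 ^+ n = 1 :> R by rewrite -exprMn mulVf ?expr1n// pnatr_eq0.
    by rewrite mulrCA e3 mulr1 [X in _ <= X -> _]mulrA.
  move: h1 h2 h4 h5 h6; rewrite exprS; set P := N _ (_ + _); set Q := N _ u.
  set th := 3^-1 ^+ n; set W := N _ (w n); set ss := sup _ => *.
  have e1 : W * (3 / 2) * (3 / 2 * (3^-1 * th)) = 3 / 4 * (th * W) by field.
  lra.
have B0 : 0 <= B * 6 by have := nB 0%N.
have /andP[_] := truncn_itv B0; rewrite ltNge => /negP; apply.
exact: nB.
Qed.

(** * Test functions and decay *)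

(** The interval is closed on the left and open on the right, so both jumps respect
    right-continuity. *)
Lemma rcont_piece (al be : R) (F : R -> X) :
  (forall s, al <= s -> forall e, 0 < e -> exists2 d, 0 < d &
     forall u, s <= u -> u < s + d -> `|F u - F s| <= e) ->
  forall b, rcont b (fun s => if al <= s < be then F s else 0).
Proof.
move=> cF b s s1 sb e e0.
have [sal|als] := ltP s al.
  exists (al - s); first by rewrite subr_gt0.
  move=> u su ub; rewrite addrC subrK => ual.
  by rewrite (lt_geF ual) /= subrr normr0 ltW.
have [bes|sbe] := leP be s.
  exists 1 => // u su ub _.
  by rewrite (le_gtF (le_trans bes su)) !andbF subrr normr0 ltW.
have [d d0 hd] := cF s als e e0.
exists (Num.min d (be - s)); first by rewrite lt_min d0 subr_gt0.
move=> u su ub ud.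
have [ud1 ud2] : u < s + d /\ u < be.
  by apply/andP; move: ud; rewrite -!ltrBlDl lt_min ltrD2r.
by rewrite (le_trans als su) ud2 /= hd.
Qed.

(** The factor [s] cancels the [s^-1] of the integral and [al] is the length of the support, so the
    output is exactly [T t tau x] once the support is passed. *)
Definition piece (al tau : R) (x : X) (s : R) : X :=
  if al <= s < al + al then (s / al) *: T s tau x else 0.

Lemma piece_rcont al tau x b : 1 <= tau -> tau <= al -> rcont b (piece al tau x).
Proof.
move=> tau1 ta; apply: rcont_piece => s als e e0.
have al0 : 0 < al by rewrite (lt_le_trans ltr01)// (le_trans tau1).
have ts := le_trans ta als.
pose k := `|T s tau x| / al; have k0 : 0 <= k by rewrite divr_ge0// ltW.
have k1 : 0 < k + 1 by rewrite ltr_wpDl.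
pose q := (s + 1) / al.
have q0 : 0 < q by rewrite divr_gt0// ltr_wpDl// (le_trans _ als)// ltW.
have e2 : 0 < e / 2 by rewrite divr_gt0.
have eq : 0 < e / 2 / q by rewrite divr_gt0.
have [d d0 hd] := T_cont x tau1 ts eq.
exists (Num.min 1 (Num.min d (e / 2 / (k + 1)))).
  by rewrite !lt_min ltr01 d0 divr_gt0.
move=> u su; rewrite -ltrBlDl !lt_min => /and3P[u1 ud uk].
have us : 0 <= u - s by rewrite subr_ge0.
rewrite -(subrK ((u / al) *: T s tau x) ((u / al) *: T u tau x)) -addrA.
apply: le_trans (ler_normD _ _) _; rewrite [e]splitr lerD//.
  rewrite -scalerBr normrZ.
  apply: le_trans (_ : q * (e / 2 / q) <= _); last by rewrite mulrC divfK ?gt_eqF.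
  apply: ler_pM => //; last first.
    by apply: hd; [exact: le_trans su|rewrite ger0_norm].
  rewrite ger0_norm; first by rewrite /q ler_pM2r ?invr_gt0//; lra.
  by rewrite divr_ge0 ?(ltW al0)// (le_trans _ (le_trans als su))// ltW.
rewrite -scalerBl normrZ -mulrBl normrM (ger0_norm us) ger0_norm ?invr_ge0 ?(ltW al0)//.
rewrite -mulrA [al^-1 * _]mulrC -/k.
apply: le_trans (_ : e / 2 / (k + 1) * k <= _).
  by rewrite ler_wpM2r// ltW.
by rewrite mulrAC -mulrA ler_piMr ?(ltW e2)// ler_pdivrMr//; lra.
Qed.

(** By the cocycle law the integrand is the constant [al^-1 *: T t tau x] on the support, hence a
    simple function. *)
Lemma piece_Lam al tau x t : 1 <= tau -> tau <= al -> al + al <= t ->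
  Lam t (piece al tau x) (T t tau x).
Proof.
move=> tau1 ta at_; have al0 : 0 < al by rewrite (lt_le_trans ltr01)// (le_trans tau1).
set w := T t tau x.
pose l : seq (set R * X) := [:: (`[al, (al + al)%R[%classic, al^-1 *: w)].
have ml : smeas l by split => //; exact: measurable_itv.
have -> : w = sint `[1, t]%classic l.
  rewrite /sint big_cons big_nil addr0 /= setIidl.
    rewrite lebesgue_measure_itv /= lte_fin ltrDr al0 -EFinB addrK /=.
    by rewrite scalerA mulfV ?gt_eqF// scale1r.
  move=> s; rewrite /= !in_itv /= => /andP[als sal].
  by rewrite (le_trans _ als) ?(le_trans tau1)// (le_trans (ltW sal)).
apply: (bochner_eq (measurable_itv _) (itv_measure_fin _ _) _
  (bochner_simple (measurable_itv _) (itv_measure_fin _ _) ml)).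
move=> s; rewrite /= in_itv /= => /andP[s1 st].
rewrite /sfun big_cons big_nil addr0 indicE /piece /=.
case: ifP => [/andP[als sal]|nals].
  rewrite mem_set /=; last by rewrite in_itv /= als.
  have s0 : 0 < s by rewrite (lt_le_trans ltr01).
  rewrite scale1r T_scale// scalerA mulrA mulVf ?gt_eqF// mul1r.
  by case: evT => _ _ co _; rewrite co// (le_trans ta).
rewrite memNset ?scale0r /=; last by rewrite in_itv /= nals.
by rewrite T_0// scaler0.
Qed.

(** The scalar [1] gives the sum the shape expected by [Lam_lin]. *)
Fixpoint pieces (tau : R) (x : X) n : R -> X :=
  if n is k.+1 then fun s => pieces tau x k s + 1 *: piece (2 ^+ k * tau) tau x s
  else fun=> 0.

Lemma pow2_ge (tau : R) n : 1 <= tau -> tau <= 2 ^+ n * tau.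
Proof.
by move=> tau1; rewrite ler_peMl ?(le_trans ler01)// exprn_ege1// ler1n.
Qed.

Lemma pow2_double (tau : R) n : 2 ^+ n * tau + 2 ^+ n * tau = 2 ^+ n.+1 * tau.
Proof. by rewrite exprS; ring. Qed.

Lemma pieces_Lam tau x n t : 1 <= tau -> 2 ^+ n * tau <= t ->
  Lam t (pieces tau x n) (n%:R *: T t tau x).
Proof.
move=> tau1; elim: n => [|n IH] tn.
  have t1 : 1 <= t by apply: le_trans tn; rewrite expr0 mul1r.
  rewrite scale0r; have [v Lv] := Lam_exists (inV_Y1 inV0) t1.
  have v0 : v = 0.
    apply/eqP; rewrite -normr_le0; apply: le_trans (norm_le_N _ t1) _.
    by have := Lam_inV_bound t1 inV0 Lv; rewrite mulr0 mul0r.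
  by rewrite v0 in Lv.
rewrite -natr1 scalerDl; apply: Lam_lin.
  apply: IH; apply: le_trans tn; rewrite -pow2_double lerDl.
  by rewrite (le_trans _ (pow2_ge n tau1))// (le_trans ler01).
by apply: piece_Lam; rewrite ?pow2_double// pow2_ge.
Qed.

(** On each block [s / al] stays below 2, and the blocks are disjoint, so the bound does not grow
    with [n] while the output does. *)
Lemma pieces_inV tau x n c : 1 <= tau -> 0 <= c ->
  (forall s, tau <= s -> s <= 2 ^+ n * tau -> N s (T s tau x) <= c) ->
  inV (2 * c) (pieces tau x n).
Proof.
move=> tau1 c0 hc; split.
  move=> b; elim: n {hc} => [|n IH]; first exact: inV0.1.
  move=> s s1 sb e e0; have e2 : 0 < e / 2 by rewrite divr_gt0.
  have [d1 d10 h1] := IH s s1 sb _ e2.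
  have [d2 d20 h2] := piece_rcont x (b := b) tau1 (pow2_ge n tau1) s1 sb e2.
  exists (Num.min d1 d2); first by rewrite lt_min d10.
  move=> u su ub ud.
  have [ud1 ud2] : u < s + d1 /\ u < s + d2.
    by apply/andP; move: ud; rewrite -!ltrBlDl lt_min.
  rewrite /= !scale1r opprD addrACA [e]splitr.
  by apply: le_trans (ler_normD _ _) _; rewrite lerD ?h1 ?h2.
move=> s s1; have c2 : 0 <= 2 * c by rewrite mulr_ge0.
(* Vanishing from [2 ^+ n * tau] on is carried through the induction: it expresses that the next
   block is disjoint from the earlier ones. *)
suff [h1 h2] : (s < 2 ^+ n * tau -> N s (pieces tau x n s) <= 2 * c) /\
    (2 ^+ n * tau <= s -> pieces tau x n s = 0).
  have [/h2 ->|] := leP (2 ^+ n * tau) s; last exact: h1.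
  by rewrite seminorm0//; exact: N_seminorm.
elim: n hc => [|n IH] hc; first by rewrite /= seminorm0//; exact: N_seminorm.
have [|h1 h2] := IH.
  move=> u tu un; apply: hc => //; apply: le_trans un _.
  by rewrite -pow2_double lerDl (le_trans _ (pow2_ge n tau1))// (le_trans ler01).
have p0 : 0 < 2 ^+ n * tau by rewrite (lt_le_trans ltr01)// (le_trans _ (pow2_ge n tau1)).
rewrite /= scale1r /piece pow2_double; split.
  move=> sn; rewrite sn andbT; case: ifP => [ns|]; last first.
    by rewrite addr0 => /negbT; rewrite -ltNge; exact: h1.
  rewrite (h2 ns) add0r (N_seminorm s1).2 ger0_norm; last first.
    by rewrite divr_ge0 ?(ltW p0)// (le_trans ler01).
  apply: ler_pM; rewrite ?N_ge0 ?divr_ge0 ?(ltW p0) ?(le_trans ler01)//.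
    by rewrite ler_pdivrMr// mulrA -exprS ltW.
  by apply: hc; [exact: le_trans (pow2_ge n tau1) ns|exact: ltW].
move=> sn; rewrite (le_gtF sn) andbF addr0; apply: h2; apply: le_trans sn.
by rewrite -pow2_double lerDl ltW.
Qed.

(** * Polynomial decay from the uniform bound *)

Lemma decay_of_bound K c tau x n t : 0 <= K ->
  (forall t c y v, 1 <= t -> inV c y -> Lam t y v -> N t v <= K * c) ->
  1 <= tau -> 0 <= c -> 2 ^+ n * tau <= t ->
  (forall s, tau <= s -> s <= 2 ^+ n * tau -> N s (T s tau x) <= c) ->
  n%:R * N t (T t tau x) <= K * (2 * c).
Proof.
move=> K0 hK tau1 c0 tn hc.
have t1 : 1 <= t by rewrite (le_trans tau1)// (le_trans (pow2_ge n tau1)).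
have := hK t _ _ _ t1 (pieces_inV tau1 c0 hc) (pieces_Lam x tau1 tn).
by rewrite (N_seminorm t1).2 ger0_norm.
Qed.

Lemma uniform_bound_decay K : 0 <= K ->
  (forall t c y v, 1 <= t -> inV c y -> Lam t y v -> N t v <= K * c) ->
  exists lam D : R, [/\ 0 < lam, 0 < D & forall x t tau, 1 <= tau -> tau <= t ->
    N t (T t tau x) <= D * (t / tau) `^ (- lam) * N tau x].
Proof.
move=> K0 hK; case: evT => _ Tid Tco _.
(* Up to [2 * tau] the growth estimate gives [M * powR 2 a]; beyond, [decay_of_bound] with [n = 1]
   gives [2 * K] times that. [L] is the sum of the two. *)
pose L := M * 2 `^ a * (2 * K + 1).
have Ma : 0 < M * 2 `^ a by rewrite mulr_gt0// powR_gt0.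
have L0 : 0 < L by rewrite mulr_gt0// ltr_wpDl// mulr_ge0.
have short x s tau : 1 <= tau -> tau <= s -> s <= 2 * tau ->
    N s (T s tau x) <= M * 2 `^ a * N tau x.
  move=> tau1 ts s2; have tau0 : 0 < tau by rewrite (lt_le_trans ltr01).
  apply: le_trans (growth _ tau1 ts) _; rewrite ler_wpM2r ?N_ge0//.
  rewrite ler_wpM2l ?(ltW M0)//; apply: ge0_ler_powR; rewrite ?(ltW a0)//.
  - by rewrite nnegrE divr_ge0 ?(ltW tau0)// (le_trans _ ts)// ltW.
  - by rewrite nnegrE.
  - by rewrite ler_pdivrMr.
have bnd x t tau : 1 <= tau -> tau <= t -> N t (T t tau x) <= L * N tau x.
  move=> tau1 tt; have n0 := N_ge0 x tau1.
  have cn0 : 0 <= M * 2 `^ a * N tau x by rewrite mulr_ge0// ltW.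
  have [t2|t2] := leP t (2 * tau).
    apply: le_trans (short x t tau tau1 tt t2) _.
    have -> : L * N tau x = M * 2 `^ a * N tau x * (2 * K + 1) by rewrite /L; ring.
    by rewrite ler_peMr//; lra.
  have := @decay_of_bound K (M * 2 `^ a * N tau x) tau x 1 t K0 hK tau1 cn0.
  rewrite expr1 mul1r => /(_ (ltW t2) (fun s => short x s tau tau1)) /le_trans; apply.
  have -> : L * N tau x = K * (2 * (M * 2 `^ a * N tau x)) + M * 2 `^ a * N tau x.
    by rewrite /L; ring.
  by rewrite lerDl.
(* [decay_of_bound] with the constant [L] gives [K * (2 * L) / n%:R], which is at most [1 / 2] for
   this [n]. *)
clearbody L; have [n n0 hn] : exists2 n : nat, (0 < n)%N & K * (2 * L) * 2 <= n%:R.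
  have q0 : 0 <= K * (2 * L) * 2 by rewrite !mulr_ge0// ltW.
  exists (Num.truncn (K * (2 * L) * 2)).+1 => //.
  by have /andP[_ /ltW] := truncn_itv q0.
have nR : 0 < n%:R :> R by rewrite ltr0n.
have half x t tau : 1 <= tau -> 2 ^+ n * tau <= t -> N t (T t tau x) <= 2^-1 * N tau x.
  move=> tau1 tn; have nn0 := N_ge0 x tau1.
  have := @decay_of_bound K (L * N tau x) tau x n t K0 hK tau1 _ tn.
  have LN : 0 <= L * N tau x by rewrite mulr_ge0// ltW.
  move=> /(_ LN (fun s ts _ => bnd x s tau tau1 ts)) h.
  rewrite -(ler_pM2l nR); apply: le_trans h _.
  have := ler_wpM2r nn0 hn; nra.
(* With this exponent a factor [2 ^+ n] in time corresponds exactly to a factor 2 in the weight. *)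
pose lam := n%:R^-1 : R; have l0 : 0 < lam by rewrite invr_gt0.
have lamE : (2 ^+ n) `^ lam = 2 :> R.
  by rewrite -powR_mulrn// -powRrM mulfV ?gt_eqF// powRr1.
exists lam, (2 * L); split => //; first by rewrite mulr_gt0.
suff main : forall (k : nat) x t tau, 1 <= tau -> tau <= t -> t <= (2 ^+ n) ^+ k * tau ->
    N t (T t tau x) <= 2 * L * (t / tau) `^ (- lam) * N tau x.
  move=> x t tau tau1 tt; have t0 : 0 <= t by rewrite (le_trans ler01)// (le_trans tau1).
  apply: (main (Num.truncn t).+1) => //.
  have /andP[_ /ltW /le_trans] := truncn_itv t0; apply.
  apply: (@le_trans _ _ ((2 ^+ n) ^+ (Num.truncn t).+1)); last first.
    by rewrite ler_peMr// exprn_ge0// exprn_ge0.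
  apply: (@le_trans _ _ (2 ^+ (Num.truncn t).+1)).
    by rewrite -natrX ler_nat ltnW// ltn_expl.
  rewrite lerXn2r ?nnegrE ?exprn_ge0//.
  by rewrite -[leLHS]expr1 ler_weXn2l// ler1n.
(* Over the first block the weight is at least [1 / 2], which the 2 in [2 * L] compensates. *)
have within_theta x t tau : 1 <= tau -> tau <= t -> t <= 2 ^+ n * tau ->
    N t (T t tau x) <= 2 * L * (t / tau) `^ (- lam) * N tau x.
  move=> tau1 tt tn; have tau0 : 0 < tau by rewrite (lt_le_trans ltr01).
  have t0 : 0 < t by rewrite (lt_le_trans tau0).
  apply: le_trans (bnd x t tau tau1 tt) _; rewrite ler_wpM2r ?N_ge0//.
  rewrite powRN ler_pdivlMr ?powR_gt0 ?divr_gt0// mulrC ler_wpM2r ?(ltW L0)//.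
  rewrite -lamE; apply: ge0_ler_powR; rewrite ?(ltW l0)//.
  - by rewrite nnegrE divr_ge0 ?ltW.
  - by rewrite nnegrE exprn_ge0.
  - by rewrite ler_pdivrMr.
elim=> [|k IH] x t tau tau1 tt tk.
  apply: within_theta => //; apply: le_trans tk _; rewrite expr0 mul1r; exact: pow2_ge.
have [tn|/ltW tn] := leP t (2 ^+ n * tau); first exact: within_theta.
have tau0 : 0 < tau by rewrite (lt_le_trans ltr01).
have t0 : 0 < t by rewrite (lt_le_trans tau0).
have p1 := pow2_ge n tau1; have q1 := le_trans tau1 p1.
have q0 : 0 < 2 ^+ n * tau by rewrite (lt_le_trans ltr01).
rewrite -(Tco t (2 ^+ n * tau) tau x)//.
apply: le_trans (IH _ t (2 ^+ n * tau) q1 tn _) _.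
  by rewrite mulrA -exprSr.
(* Restarting from [2 ^+ n * tau] doubles the weight; the factor [1 / 2] from [half] makes up for
   it. *)
have -> : (t / (2 ^+ n * tau)) `^ (- lam) = 2 * (t / tau) `^ (- lam).
  rewrite (_ : t / _ = (t / tau) * (2 ^+ n)^-1); last first.
    by field; rewrite !gt_eqF ?exprn_gt0.
  rewrite powRM ?divr_ge0 ?invr_ge0 ?exprn_ge0 ?(ltW t0) ?(ltW tau0)//.
  rewrite mulrC; congr (_ * _).
  by rewrite -powR_inv1 ?exprn_ge0// -powRrM mulrNN mul1r.
have := half x _ tau tau1 (lexx _); have pp := powR_ge0 (t / tau) (- lam).
have LP : 0 <= 2 * L * (2 * (t / tau) `^ (- lam)) by rewrite !mulr_ge0// ltW.
by move=> /(ler_wpM2l LP) /le_trans; apply; lra.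
Qed.

Lemma admissible_imp_contraction :
  (forall y, in_Y1 N y -> exists x : R -> X, in_Y0 N x /\
     forall t, 1 <= t -> Lam t y (x t)) ->
  polynomial_contraction T N.
Proof.
move=> adm; have [K K0 hK] := uniform_bound adm.
have [lam [D [l0 D0 hD]]] := uniform_bound_decay K0 hK.
split => //.
- move=> t t1; split => //; split => //.
  by exists 1 => u; rewrite mul1r.
(* With identity projections all kernels are zero, so invertibility and the backward estimate
   concern the vector 0. *)
- move=> t tau tau1 tt z ->; exists 0; split; last by move=> w [->].
  by split => //; rewrite T_0.
- exists lam, D; split => //; split => //; split => // x t tau t1 tt z -> _.
  rewrite seminorm0; last exact: N_seminorm.
  by rewrite !mulr_ge0 ?powR_ge0 ?N_ge0 ?(ltW D0)// (le_trans t1).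
Qed.

End evolution.

Theorem theorem3p3 (R : realType) (X : completeNormedModType R)
  (T : R -> R -> X -> X) (N : R -> X -> R) :
  evolution_family T -> norm_family N ->
  (exists M a : R, 0 < M /\ 0 < a /\
     forall t s x, 1 <= s -> s <= t -> N t (T t s x) <= M * (t / s) `^ a * N s x) ->
  (polynomial_contraction T N <->
   forall y : R -> X, in_Y1 N y ->
     exists x : R -> X, in_Y0 N x /\
       forall t, 1 <= t ->
         bochner_integral `[1, t] (fun s => s^-1 *: T t s (y s)) (x t)).
Proof.
move=> evT nfN [M [a [M0 [a0 growth]]]]; split => [contr y y1|adm].
  exact: (contraction_imp_Y0 evT nfN M0 a0 growth y1 contr).
exact: (admissible_imp_contraction evT nfN M0 a0 growth adm).
Qed.
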